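(* Let $\Omega=\{x\in\mathbb{R}^N:x_N>0\}$ and $s\in(1/2,1)$. Let $\psi\in C^{1,\beta}(\Omega)$ for some $\beta>2s-1$. Then the operator $$\mathcal{L}[\psi](x)=\gamma\nu_0^{1-2s}\Gamma(2s+1)\,\mathrm{P.V.}\int_{\mathbb{R}^N}\big[\tilde\psi(y,y-x)-\psi(x)\big]\frac{1}{|y-x|^{N+2s}}\,dy$$ is given by $$\mathcal{L}[\psi](x)=\gamma\nu_0^{1-2s}\Gamma(2s)\,\mathrm{P.V.}\int_\Omega\frac{y-x}{|y-x|^{N+2s}}\cdot\nabla_y\psi(y)\,dy\qquad\forall x\in\Omega.$$
   Context: Constants: $N\ge1$, $\nu_0>0$, $\gamma>0$. Write $x=(x',x_N)$. $C^{1,\beta}(\Omega)$, $\beta\in(0,1)$, is the set of $\psi\in C^1(\Omega)$ such that $\nabla\psi$ is bounded and Hölder continuous of exponent $\beta$ on $\Omega$. Extension: for $x\in\Omega$, $\tilde\psi(y,y-x)=\psi(y)$ if $y_N>0$, and $\tilde\psi(y,y-x)=\psi\big(y'-\tfrac{y_N}{y_N-x_N}(y'-x'),0\big)$ if $y_N<0$ (the boundary value of $\psi$ at the point where the segment from $x$ to $y$ meets $\partial\Omega$). *)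

(* Defs.v *)
From HB Require Import structures.
From mathcomp Require Import all_boot all_order all_algebra.
From mathcomp Require Import all_classical all_reals all_analysis.

Set Implicit Arguments.
Unset Strict Implicit.
Unset Printing Implicit Defensive.
Import Order.TTheory GRing.Theory Num.Theory.
Import numFieldNormedType.Exports.

Local Open Scope classical_set_scope.
Local Open Scope ring_scope.

Fact rV_display : measure_display.
Proof. exact: default_measure_display. Qed.

Section measurable_rV.
Context {R : realType} {n : nat}.

(* The product sigma-algebra, generated by the coordinate functions. *)
Let coors : 'I_n -> 'rV[R]_n -> R := fun i x => x 0 i.

Let rV_set0 : g_sigma_preimage coors set0.
Proof. exact: sigma_algebra0. Qed.

Let rV_setC A : g_sigma_preimage coors A -> g_sigma_preimage coors (~` A).
Proof. exact: sigma_algebraC. Qed.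

Let rV_bigcup (F : (set 'rV[R]_n)^nat) :
  (forall i, g_sigma_preimage coors (F i)) ->
  g_sigma_preimage coors (\bigcup_i (F i)).
Proof. exact: sigma_algebra_bigcup. Qed.

HB.instance Definition _ := @isMeasurable.Build rV_display
  'rV[R]_n (g_sigma_preimage coors) rV_set0 rV_setC rV_bigcup.

End measurable_rV.

Section lebesgue_rV.
Context {R : realType}.

(* Inverse of the splitting [x |-> (x', x_N)] of [R^n.+1]. *)
Definition rV_snoc n (p : 'rV[R]_n * measurableTypeR R) : 'rV[R]_n.+1 :=
  \row_(i < n.+1) if unlift ord_max i is Some j then p.1 0 j else p.2.

Lemma measurable_coord n (i : 'I_n) :
  measurable_fun setT (fun x : 'rV[R]_n => x 0 i : measurableTypeR R).
Proof.
move=> _ Y mY; rewrite setTI; apply: sub_sigma_algebra => /=.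
rewrite -bigcup_seq/=; exists i => /=; first by rewrite mem_index_enum.
by exists Y => //; rewrite setTI.
Qed.

Lemma measurable_rV_snoc n : measurable_fun setT (@rV_snoc n).
Proof.
apply: (@measurability _ _ _ 'rV[R]_n.+1 setT (@rV_snoc n)
  (\big[setU/set0]_(i < n.+1)
    preimage_set_system setT (fun x : 'rV[R]_n.+1 => x 0 i) measurable))
  => // _ [B + <-].
rewrite -bigcup_seq/= => -[i _ [Y mY <-]].
rewrite !setTI -comp_preimage.
have mi : measurable_fun setT
    (fun p : 'rV[R]_n * measurableTypeR R => rV_snoc p 0 i : measurableTypeR R).
  rewrite /rV_snoc; under eq_fun do rewrite mxE.
  case: (unlift ord_max i) => [j|]; last exact: measurable_snd.
  apply: (@measurableT_comp _ _ _ _ _ _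
    (fun x : 'rV[R]_n => x 0 j : measurableTypeR R)) => //.
  exact: measurable_coord.
by rewrite -[X in measurable X]setTI; exact: mi.
Qed.

(* The product of [mu], in the first [n] coordinates, and of the one-dimensional
   Lebesgue measure in the last one. *)
Definition rV_snoc_measure n (mu : {measure set 'rV[R]_n -> \bar R}) :
    set 'rV[R]_n.+1 -> \bar R :=
  pushforward (mu \x @lebesgue_measure R)%E (@rV_snoc n).

HB.instance Definition _ n mu := Measure.copy (@rV_snoc_measure n mu)
  (measure_function_pushforward__canonical__measure_function_Measure
    (mu \x @lebesgue_measure R)%E (@measurable_rV_snoc n)).

Fixpoint lebesgue_rV n : {measure set 'rV[R]_n -> \bar R} :=
  if n is m.+1 then rV_snoc_measure (lebesgue_rV m)
  else dirac (0 : 'rV[R]_0).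

End lebesgue_rV.

Section euclidean.
Context {R : realType} {n : nat}.
Implicit Types (u v x : 'rV[R]_n) (U : set 'rV[R]_n) (f : 'rV[R]_n -> R).

Definition dotv u v : R := \sum_i u 0 i * v 0 i.

(* The norm [`|u|] of the library is the sup norm. *)
Definition enorm u : R := Num.sqrt (dotv u u).

Definition grad f x : 'rV[R]_n := \row_i 'D_(delta_mx 0 i) f x.

Definition C1 U f :=
  forall x, U x -> differentiable f x /\ {for x, continuous (grad f)}.

Definition C1beta (beta : R) U f :=
  [/\ C1 U f,
      exists M, forall x, U x -> enorm (grad f x) <= M &
      exists K, forall x y, U x -> U y ->
        enorm (grad f x - grad f y) <= K * enorm (x - y) `^ beta].

End euclidean.

Section principal_value.
Context {R : realType} {n : nat}.
Implicit Types (D : set 'rV[R]_n) (x : 'rV[R]_n) (f : 'rV[R]_n -> R).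

Definition pv_dom D x (e : R) := D `&` [set y | e < enorm (y - x)].

(* The principal value exists: the truncated integrals converge absolutely, and
   have a finite limit. *)
Definition pv_exists D x f :=
  (forall e, 0 < e ->
    (lebesgue_rV n).-integrable (pv_dom D x e) (EFin \o f)) /\
  cvg (\int[lebesgue_rV n]_(y in pv_dom D x e) f y @[e --> 0^'+]).

Definition pv D x f : R :=
  lim (\int[lebesgue_rV n]_(y in pv_dom D x e) f y @[e --> 0^'+]).

End principal_value.

Definition Gamma {R : realType} (z : R) : R :=
  \int[lebesgue_measure]_(t in `]0, +oo[) (t `^ (z - 1) * expR (- t)).

Section half_space.
Context {R : realType} {n : nat}.
Implicit Types (x y v z : 'rV[R]_n.+1) (psi : 'rV[R]_n.+1 -> R).

Definition half_space : set 'rV[R]_n.+1 := [set x | 0 < x 0 ord_max].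

(* [psi] is only meaningful in the open half-space, so that its value at a
   boundary point is the limit from inside. *)
Definition boundary_value psi z : R :=
  lim (psi y @[y --> within half_space (nbhs z)]).

(* For [v = y - x], the point at which the segment from [x] to [y] meets the
   boundary. *)
Definition hit_point y v : 'rV[R]_n.+1 :=
  \row_i (if i == ord_max then 0
          else y 0 i - y 0 ord_max / v 0 ord_max * v 0 i).

(* On the null set [y_N = 0], this is the boundary value of [psi] at [y]. *)
Definition extension psi y v : R :=
  if 0 < y 0 ord_max then psi y else boundary_value psi (hit_point y v).

Definition kernel (s : R) v : R := (enorm v `^ (n.+1%:R + 2 * s))^-1.

Definition jump_integrand (s : R) psi x y : R :=
  (extension psi y (y - x) - psi x) * kernel s (y - x).

Definition grad_integrand (s : R) psi x y : R :=
  dotv (kernel s (y - x) *: (y - x)) (grad psi y).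

Definition calL (gamma nu0 s : R) psi x : R :=
  gamma * nu0 `^ (1 - 2 * s) * Gamma (2 * s + 1) *
  pv setT x (jump_integrand s psi x).

End half_space.

(* Main.v *)
(** Put [T_t y = x + t (y - x)].  Integrating along the segment from [x] to [y],
    up to the point where it leaves the half-space [Omega], the extension of
    [psi] at [y] minus [psi x] is the integral over [0 < t < 1] of
    [(y - x) . grad psi (T_t y)], with [grad psi] replaced by 0 outside [Omega].
    By Fubini and the change of variables [y |-> T_t y], under which the kernel
    is homogeneous, the truncated jump integral [F] and the truncated gradient
    integral [G] satisfy [F e = \int_0^1 t^(2s-1) G (t e) dt].  By oddness of the
    kernel and Hölder continuity, [G e] has a limit [L] as [e] tends to 0, hence
    [F e] tends to [L / (2 s)], and [Gamma (2s+1) = 2s Gamma (2s)]. *)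
Require Import Defs.
From HB Require Import structures.
From mathcomp Require Import all_boot all_order all_algebra.
From mathcomp Require Import all_classical all_reals all_analysis.
From mathcomp Require Import measurable_realfun.
From mathcomp Require Import ring lra.
Import Order.TTheory GRing.Theory Num.Theory.
Import numFieldNormedType.Exports.
Local Open Scope classical_set_scope.
Local Open Scope ring_scope.

(** * Lebesgue measure on row vectors *)

Section lebesgue_affine.
Context {R : realType}.

(** The two conditions on the exponents act in different places, with N = [n.+1]. The bound
    [1 < 2 * s] makes |y - x|^(1-N-2s) integrable away from x; for a fixed truncation radius this
    majorant does not depend on t, which justifies Fubini. The bound [2 * s - 1 < beta] makes |y -
    x|^(beta+1-N-2s) integrable near x and serves only to give [G] a limit. The truncation has to
    stay during Fubini, because near x the double integral need not converge absolutely. It survives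
    the change of variables because T_t maps |y - x| > e onto |z - x| > t e. Extending the gradient
    by 0 destroys its continuity across the boundary. The Fubini part therefore assumes only a
    bounded measurable field, and the principal value part adds only a Hölder bound on a ball around
    x. All estimates on powers of the Euclidean norm come from the scaling of Lebesgue measure,
    without polar coordinates; the scaling itself follows the recursive definition of
    [lebesgue_rV]. *)

Lemma measurable_rV {d} {T : measurableType d} {n} (f : T -> 'rV[R]_n) :
  (forall i, measurable_fun setT (fun t => f t 0 i)) -> measurable_fun setT f.
Proof.
move=> mf.
apply: (@measurability _ _ _ 'rV[R]_n setT f
  (\big[setU/set0]_(i < n)
    preimage_set_system setT (fun x : 'rV[R]_n => x 0 i) measurable))
  => // _ [B + <-].
rewrite -bigcup_seq/= => -[i _ [Y mY <-]].
rewrite !setTI -comp_preimage -[X in measurable X]setTI.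
exact: mf.
Qed.

Lemma measurable_affine n (a : R) (b : 'rV[R]_n) :
  measurable_fun setT (fun x : 'rV[R]_n => a *: x + b).
Proof.
apply: measurable_rV => i; under eq_fun do rewrite !mxE.
apply: measurable_funD; last exact: measurable_cst.
apply: measurable_funM; first exact: measurable_cst.
exact: measurable_coord.
Qed.

(** For a positive factor, the rescaled pushforward agrees with Lebesgue measure on half-open
    intervals, hence everywhere by uniqueness. A negative factor is reduced to this case by the
    reflection invariance of Lebesgue measure. *)
Lemma lebesgue_measure_affine (a b : R) (A : set R) : a != 0 ->
  measurable A ->
  lebesgue_measure ((fun t => a * t + b) @^-1` A) =
  (`|a|^-1%:E * lebesgue_measure A)%E.
Proof.
have maff (c d : R) : measurable_fun setT
      (fun t : measurableTypeR R => c * t + d : measurableTypeR R).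
  by apply: measurable_funD => //; apply: measurable_funM.
have pos (c d : R) (B : set R) : 0 < c -> measurable B ->
    lebesgue_measure ((fun t => c * t + d) @^-1` B) =
    (c^-1%:E * lebesgue_measure B)%E.
  move=> c0 mB.
  pose m : {measure set measurableTypeR R -> \bar R} :=
    mscale (NngNum (ltW c0))
      (measure_function_pushforward__canonical__measure_function_Measure
        (@lebesgue_measure R) (maff c d)).
  have -> : lebesgue_measure B = m B.
    apply: lebesgue_measure_unique => // _ [[u v]] _ <- /=.
    rewrite /m /mscale/= /pushforward.
    have -> : (fun t => c * t + d) @^-1` `]u, v] = `](u - d) / c, (v - d) / c]%classic.
      apply/seteqP; split => t /=; rewrite !in_itv/=;
       rewrite ltr_pdivrMr// ler_pdivlMr// ltrBlDr lerBrDr mulrC//.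
    rewrite !lebesgue_measure_itv/= !lte_fin ltr_pM2r ?invr_gt0// ltrD2r.
    case: ifPn => // _; last by rewrite mule0.
    rewrite -!EFinD -EFinM; congr EFin; field; exact: lt0r_neq0.
  rewrite /m /mscale/= /pushforward muleA -EFinM mulVf ?mul1e//; exact: lt0r_neq0.
move=> a0 mA; have [agt|alt|/eqP] := ltgtP a 0; last by rewrite (negbTE a0).
  have mNA : measurable ((-%R : R -> R) @^-1` A).
    rewrite -[X in measurable X]setTI; exact: oppr_measurable.
  have -> : (fun t => a * t + b) @^-1` A = (fun t => (- a) * t + (- b)) @^-1` (-%R @^-1` A).
    by apply/seteqP; split => t /=; rewrite mulNr -opprD opprK.
  rewrite pos ?oppr_gt0// ltr0_norm//; congr (_ * _)%E.
  exact: lebesgue_measureN.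
by rewrite pos// gtr0_norm.
Qed.

Lemma lebesgue_rVS n (A : set 'rV[R]_n.+1) : lebesgue_rV n.+1 A =
  (\int[lebesgue_rV n]_p
     lebesgue_measure (xsection (@rV_snoc R n @^-1` A) p))%E.
Proof. by []. Qed.

Lemma rV_snoc_affine n (a : R) (b : 'rV[R]_n.+1) p t :
  a *: rV_snoc (p, t) + b =
  rV_snoc (a *: p + \row_i b 0 (lift ord_max i), a * t + b 0 ord_max).
Proof.
apply/rowP => i; rewrite !mxE/=; case: unliftP => [j|] ->/=; by rewrite ?mxE.
Qed.

(** Induction on the dimension: a section of the preimage is the affine preimage of a section, which
    gives one factor |a|^-1 in the last coordinate and leaves an affine change of variables in the
    first [n]. *)
Lemma lebesgue_rV_affine n (a : R) (b : 'rV[R]_n) (A : set 'rV[R]_n) : a != 0 ->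
  measurable A ->
  lebesgue_rV n ((fun x => a *: x + b) @^-1` A) =
  ((`|a|^-1 ^+ n)%:E * lebesgue_rV n A)%E.
Proof.
move=> a0; elim: n b A => [|n ih] b A mA.
  rewrite expr0 mul1e /=; congr dirac => //.
  by apply/seteqP; split => x/=; rewrite !(thinmx0 _).
rewrite !lebesgue_rVS.
pose phi := fun x : 'rV[R]_n.+1 => a *: x + b; rewrite -/phi.
pose b' : 'rV[R]_n := \row_i b 0 (lift ord_max i).
have mS : measurable (@rV_snoc R n @^-1` A).
  by rewrite -[X in measurable X]setTI; exact: measurable_rV_snoc.
have xE p : xsection (@rV_snoc R n @^-1` (phi @^-1` A)) p =
    (fun t => a * t + b 0 ord_max) @^-1` xsection (@rV_snoc R n @^-1` A) (a *: p + b').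
  by apply/seteqP; split => t /=; rewrite /xsection/= !inE/= /phi rV_snoc_affine.
under eq_integral.
  move=> p _; rewrite xE lebesgue_measure_affine//; last exact: measurable_xsection.
  over.
pose h p := lebesgue_measure (xsection (@rV_snoc R n @^-1` A) p).
have mh : measurable_fun setT h by exact: measurable_fun_xsection.
rewrite ge0_integralZl//=; last exact: (measurableT_comp mh (@measurable_affine n a b')).
have maff := @measurable_affine n a b'.
pose r : {nonneg R} := NngNum (exprn_ge0 n (normr_ge0 a^-1)).
pose m1 : {measure set 'rV[R]_n -> \bar R} := mscale r (lebesgue_rV n).
(* The induction hypothesis, read as an identity between measures, transports the integral of [h]
   and not only the measure of sets. *)
have m1E B : measurable B -> B `<=` setT ->
    m1 B = pushforward (lebesgue_rV n) (fun x => a *: x + b') B.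
  by move=> mB _; rewrite /pushforward ih// -normfV.
transitivity (`|a|^-1%:E * \int[m1]_p h p)%E.
  congr (_ * _)%E.
  rewrite (eq_measure_integral
    (measure_function_pushforward__canonical__measure_function_Measure
      (lebesgue_rV n) maff) m1E).
  by rewrite [RHS]ge0_integral_pushforward//; move=> y _; exact: measure_ge0.
rewrite ge0_integral_mscale// muleA -EFinM /r /= -!normfV -exprS.
by [].
Qed.

(** Cubes, unlike Euclidean balls, are split by [rV_snoc] into products, so that their measure is
    bounded by induction. *)
Definition cube n (k : R) : set 'rV[R]_n := [set x | forall i, `|x 0 i| <= k].

Lemma measurable_cube n k : measurable (cube n k).
Proof.
have -> : cube n k = \bigcap_(i in [set: 'I_n])
    ((fun x : 'rV[R]_n => x 0 i) @^-1` `[- k, k]).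
  apply/seteqP; split => x /= h i; first by move=> _; rewrite /= in_itv/= -ler_norml.
  by have /= := h i I; rewrite in_itv/= -ler_norml.
apply: fin_bigcap_measurable => // i _; rewrite -[X in measurable X]setTI.
exact: measurable_coord.
Qed.

Lemma lebesgue_rV_cube n (k : R) : 0 <= k -> (lebesgue_rV n (cube n k) < +oo)%E.
Proof.
move=> k0; elim: n => [|n ih]; first by rewrite /= diracE ltry.
rewrite [ltLHS]/= /rV_snoc_measure /pushforward.
have -> : @rV_snoc R n @^-1` cube n.+1 k = cube n k `*` `[- k, k]%classic.
  apply/seteqP; split => -[p t] /=.
    move=> h; split=> [i|].
      by have := h (lift ord_max i); rewrite mxE liftK.
    by have := h ord_max; rewrite mxE unlift_none /= in_itv/= -ler_norml.
  rewrite in_itv/= -ler_norml => -[h1 h2] i; rewrite mxE.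
  by case: unliftP => [j|] _ /=.
rewrite product_measure1E//=; last exact: measurable_cube.
rewrite lte_mul_pinfty// ?ge0_fin_numE//.
rewrite lebesgue_measure_itv/=; case: ifP => // _; rewrite -EFinB ltry//.
Qed.

Lemma lebesgue_rV_sigma_finite n : sigma_finite setT (@lebesgue_rV R n).
Proof.
exists (fun k => cube n k%:R) => [|k]; last first.
  by split; [exact: measurable_cube|exact: lebesgue_rV_cube].
apply/seteqP; split => // x _.
exists (Num.truncn (\sum_i `|x 0 i|)).+1 => // i.
apply: le_trans (ltW (truncnS_gt _)).
by rewrite (bigD1 i)//= lerDl sumr_ge0.
Qed.

(* A name for [lebesgue_rV n] to which a canonical sigma-finite structure can be
   attached, as Fubini requires. *)
Definition lebesgue_rVs n : set 'rV[R]_n -> \bar R := lebesgue_rV n.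

HB.instance Definition _ n := Measure.copy (@lebesgue_rVs n) (lebesgue_rV n).
HB.instance Definition _ n :=
  Measure_isSigmaFinite.Build _ _ _ (@lebesgue_rVs n) (@lebesgue_rV_sigma_finite n).

End lebesgue_affine.

(** * Affine changes of variables in integrals *)

Section change_of_variables.
Context {R : realType} {n : nat}.
Variables (a : R) (b : 'rV[R]_n).
Hypothesis a0 : a != 0.
Let phi (x : 'rV[R]_n) := a *: x + b.
Let mphi : measurable_fun setT phi := @measurable_affine R n a b.

Lemma measurable_affine_preimage (D : set 'rV[R]_n) :
  measurable D -> measurable (phi @^-1` D).
Proof. by move=> mD; rewrite -[X in measurable X]setTI; exact: mphi. Qed.

Lemma ge0_integral_affine (D : set 'rV[R]_n) (f : 'rV[R]_n -> \bar R) :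
  measurable D -> measurable_fun D f -> (forall x, D x -> 0 <= f x)%E ->
  (\int[lebesgue_rV n]_(x in phi @^-1` D) f (phi x) =
   (`|a|^-1 ^+ n)%:E * \int[lebesgue_rV n]_(x in D) f x)%E.
Proof.
move=> mD mf f0.
pose r : {nonneg R} := NngNum (exprn_ge0 n (normr_ge0 a^-1)).
pose m1 : {measure set 'rV[R]_n -> \bar R} := mscale r (lebesgue_rV n).
have m1E B : measurable B -> B `<=` D ->
    m1 B = pushforward (lebesgue_rV n) phi B.
  by move=> mB _; rewrite /pushforward lebesgue_rV_affine// -normfV.
transitivity (\int[m1]_(x in D) f x)%E; last first.
  by rewrite ge0_integral_mscale// /r /= -!normfV.
rewrite (eq_measure_integral
    (measure_function_pushforward__canonical__measure_function_Measure
      (lebesgue_rV n) mphi) m1E).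
by rewrite [RHS]ge0_integral_pushforward// => y /set_mem; exact: f0.
Qed.

Lemma integrable_affine (D : set 'rV[R]_n) (f : 'rV[R]_n -> R) :
  measurable D -> (lebesgue_rV n).-integrable D (EFin \o f) ->
  (lebesgue_rV n).-integrable (phi @^-1` D) (EFin \o (f \o phi)).
Proof.
move=> mD /integrableP[mf fi]; apply/integrableP; split.
  by apply: (measurable_comp mD _ mf); [exact: image_preimage_subset|exact: measurable_funTS].
rewrite (ge0_integral_affine D (fun x => `|(f x)%:E|%E))//; last exact: measurableT_comp.
by rewrite lte_mul_pinfty.
Qed.

Lemma Rintegral_affine (D : set 'rV[R]_n) (f : 'rV[R]_n -> R) :
  measurable D -> (lebesgue_rV n).-integrable D (EFin \o f) ->
  \int[lebesgue_rV n]_(x in phi @^-1` D) f (phi x) =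
  `|a|^-1 ^+ n * \int[lebesgue_rV n]_(x in D) f x.
Proof.
move=> mD fi; have mf := measurable_int _ fi.
have h1 := integrable_fin_num mD (integrable_funepos mD fi).
have h2 := integrable_fin_num mD (integrable_funeneg mD fi).
rewrite /Rintegral [in RHS]integralE -[`|a|^-1 ^+ n]/(fine (`|a|^-1 ^+ n)%:E) -fineM//; last first.
  by rewrite fin_numB h1.
rewrite muleBr//; last by rewrite fin_num_adde_defr.
rewrite -!ge0_integral_affine//; [|exact: measurable_funeneg|exact: measurable_funepos].
by congr fine; rewrite integralE; congr (_ - _)%E; apply: eq_integral => x _; rewrite !unlock. 
Qed.

End change_of_variables.

(** * Radial functions *)

Section euclidean_norm.
Context {R : realType} {n : nat}.
Implicit Types u v w : 'rV[R]_n.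

Lemma dotvv_ge0 u : 0 <= dotv u u.
Proof. by apply: sumr_ge0 => i _; rewrite -expr2 sqr_ge0. Qed.

Lemma enorm_ge0 u : 0 <= enorm u.
Proof. exact: sqrtr_ge0. Qed.

Lemma sqr_enorm u : enorm u ^+ 2 = dotv u u.
Proof. by rewrite sqr_sqrtr// dotvv_ge0. Qed.

Lemma dotvZl (c : R) u v : dotv (c *: u) v = c * dotv u v.
Proof. by rewrite /dotv mulr_sumr; apply: eq_bigr => i _; rewrite mxE mulrA. Qed.

Lemma dotvC u v : dotv u v = dotv v u.
Proof. by apply: eq_bigr => i _; rewrite mulrC. Qed.

Lemma dotvZr (c : R) u v : dotv u (c *: v) = c * dotv u v.
Proof. by rewrite dotvC dotvZl dotvC. Qed.

Lemma dotv0r u : dotv u 0 = 0.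
Proof. by rewrite -[X in dotv _ X](scale0r 0) dotvZr mul0r. Qed.

Lemma dotvBr u v w : dotv u (v - w) = dotv u v - dotv u w.
Proof. by rewrite /dotv -sumrB; apply: eq_bigr => i _; rewrite !mxE mulrBr. Qed.

Lemma enormZ (c : R) u : enorm (c *: u) = `|c| * enorm u.
Proof.
by rewrite /enorm dotvZl dotvZr mulrA -expr2 sqrtrM ?sqr_ge0// sqrtr_sqr.
Qed.

Lemma enorm0 : enorm (0 : 'rV[R]_n) = 0.
Proof. by rewrite -[X in enorm X](scale0r 0) enormZ normr0 mul0r. Qed.

Lemma enormN u : enorm (- u) = enorm u.
Proof. by rewrite -scaleN1r enormZ normrN1 mul1r. Qed.

Lemma coord_le_enorm u i : `|u 0 i| <= enorm u.
Proof.
rewrite -sqrtr_sqr ler_sqrt ?dotvv_ge0//.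
rewrite /dotv (bigD1 i)//= -expr2 lerDl; apply: sumr_ge0 => j _.
by rewrite -expr2 sqr_ge0.
Qed.

Lemma enorm_le_sum u : enorm u <= \sum_i `|u 0 i|.
Proof.
have s0 : 0 <= \sum_i `|u 0 i| by apply: sumr_ge0.
rewrite -(@ler_pXn2r _ 2)// ?nnegrE ?enorm_ge0// sqr_enorm expr2 mulr_suml.
apply: ler_sum => i _; rewrite (le_trans (ler_norm _))// normrM.
by rewrite ler_wpM2l// (bigD1 i)//= lerDl sumr_ge0.
Qed.

Lemma enorm_eq0 u : enorm u = 0 -> u = 0.
Proof.
move=> u0; apply/rowP => i; rewrite mxE; apply/normr0_eq0/eqP.
by rewrite eq_le normr_ge0 andbT -u0 coord_le_enorm.
Qed.

(** Cauchy-Schwarz: expanding the square of |w| u - |u| w gives 2 |u| |w| (|u| |w| - u.w) >= 0. The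
    one-sided bound [key] is then applied to v and to -v. *)
Lemma dotv_le u v : `|dotv u v| <= enorm u * enorm v.
Proof.
have [/enorm_eq0->|u0] := eqVneq (enorm u) 0.
  by rewrite dotvC dotv0r normr0 mulr_ge0 ?enorm_ge0.
have [/enorm_eq0->|v0] := eqVneq (enorm v) 0.
  by rewrite dotv0r normr0 mulr_ge0 ?enorm_ge0.
have ugt : 0 < enorm u by rewrite lt_def u0 enorm_ge0.
have vgt : 0 < enorm v by rewrite lt_def v0 enorm_ge0.
have key w : dotv u w <= enorm u * enorm w.
  have [/enorm_eq0->|w0] := eqVneq (enorm w) 0.
    by rewrite dotv0r mulr_ge0 ?enorm_ge0.
  have wgt : 0 < enorm w by rewrite lt_def w0 enorm_ge0.
  have := dotvv_ge0 (enorm w *: u - enorm u *: w).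
  rewrite dotvBr ![dotv (_ - _) _]dotvC !dotvBr !(dotvZl, dotvZr) -!sqr_enorm.
  rewrite (dotvC w u) => h.
  have ab : 0 < enorm u * enorm w by rewrite mulr_gt0.
  rewrite -subr_ge0 -(pmulr_rge0 _ ab); lra.
rewrite ler_norml key andbT lerNl.
by rewrite -mulN1r -dotvZr scaleN1r (le_trans (key _))// enormN.
Qed.

Lemma measurable_dotv {d} {T : measurableType d} (D : set T) (f g : T -> 'rV[R]_n) :
  (forall i, measurable_fun D (fun t => f t 0 i)) ->
  (forall i, measurable_fun D (fun t => g t 0 i)) ->
  measurable_fun D (fun t => dotv (f t) (g t)).
Proof.
move=> mf mg; apply: (@measurable_sum _ _ _ _ _ _ (fun i t => f t 0 i * g t 0 i)) => i.
exact: measurable_funM.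
Qed.

Lemma measurable_enorm : measurable_fun setT (@enorm R n).
Proof.
apply: measurableT_comp.
  by apply: continuous_measurable_fun; exact: sqrt_continuous.
by apply: measurable_dotv => i; exact: measurable_coord.
Qed.

End euclidean_norm.

Lemma powR_lt1 {R : realType} (a x : R) : 1 < a -> x < 0 -> a `^ x < 1.
Proof.
move=> a1 x0; rewrite /powR gt_eqF ?(lt_trans _ a1)// expR_lt1.
by rewrite pmulr_llt0// ln_gt0.
Qed.

Section radial.
Context {R : realType} {n : nat}.
Notation mu := (lebesgue_rV n : {measure set 'rV[R]_n -> \bar R}).
Implicit Types (q c e r : R).

(** Half-open, so that consecutive annuli are disjoint and the complement of the outer bound is the
    strict truncation [r < enorm w]. With [e = 0] it is a ball without its centre. *)
Definition annulus e r : set 'rV[R]_n := [set w | e < enorm w /\ enorm w <= r].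

Lemma measurable_enorm_gt e : measurable [set w : 'rV[R]_n | e < enorm w].
Proof.
rewrite [X in measurable X](_ : _ = setT `&` (@enorm R n @^-1` `]e, +oo[)).
  exact: measurable_enorm.
by rewrite setTI; apply/seteqP; split => w /=; rewrite in_itv/= andbT.
Qed.

Lemma measurable_annulus e r : measurable (annulus e r).
Proof.
rewrite [X in measurable X](_ : _ = setT `&` (@enorm R n @^-1` `]e, r])).
  exact: measurable_enorm.
rewrite setTI; apply/seteqP; split => w /=; rewrite in_itv/=; first by case=> -> ->.
by move=> /andP[].
Qed.

Lemma measurable_enorm_powR q D : measurable_fun D (fun w : 'rV[R]_n => (enorm w `^ q)%:E).
Proof.
apply: measurable_funTS; apply/measurable_EFinP.
apply: (measurableT_comp (measurable_powR q)); exact: measurable_enorm.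
Qed.

(** According to the sign of [q], the power is largest at the outer or at the inner radius; the
    annulus lies in a cube of finite measure. *)
Lemma annulus_powR_lty q e r : 0 < e -> e <= r ->
  (\int[mu]_(w in annulus e r) (enorm w `^ q)%:E < +oo)%E.
Proof.
move=> e0 er; pose M := Num.max (e `^ q) (r `^ q).
have r0 : 0 < r by exact: lt_le_trans er.
apply: (@le_lt_trans _ _ (\int[mu]_(w in cube n r) (M%:E))%E).
  apply: (@le_trans _ _ (\int[mu]_(w in annulus e r) (M%:E))%E).
    apply: ge0_le_integral => //=.
    - exact: measurable_annulus.
    - by move=> w _; rewrite lee_fin powR_ge0.
    - exact: measurable_enorm_powR.
    - move=> w [ew wr]; rewrite lee_fin le_max.
      have w0 : 0 < enorm w by exact: lt_trans ew.
      have [q0|q0] := leP 0 q.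
        by apply/orP; right; apply: ge0_ler_powR; rewrite ?nnegrE//; exact: ltW.
      apply/orP; left.
      rewrite -(opprK q) !(powRN _ (- q)) lef_pV2 ?posrE ?powR_gt0//.
      by apply: ge0_ler_powR; rewrite ?nnegrE ?oppr_ge0//; exact: ltW.
  apply: ge0_subset_integral => //=.
  - exact: measurable_annulus.
  - exact: measurable_cube.
  - by move=> w _; rewrite lee_fin /M le_max powR_ge0.
  - by move=> w [_ wr] i; rewrite (le_trans (coord_le_enorm _ _)).
rewrite integral_cst//=; last exact: measurable_cube.
rewrite lte_mul_pinfty ?lee_fin ?le_max ?powR_ge0//.
by apply: lebesgue_rV_cube; exact: ltW.
Qed.

(* If [J_m] is the integral over [B m], self-similarity gives
   [J_(m+1) <= J_A + c^(n+q) J_m], so that the [J_m] are bounded. *)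
Lemma selfsimilar_powR_lty q c (A : set 'rV[R]_n) (B : (set 'rV[R]_n)^nat) :
  0 < c -> c `^ (n%:R + q) < 1 ->
  measurable A -> (\int[mu]_(w in A) (enorm w `^ q)%:E < +oo)%E ->
  (forall m, measurable (B m)) -> nondecreasing_seq B -> B 0%N = set0 ->
  (forall m w, B m.+1 w -> A w \/ B m (c^-1 *: w)) ->
  (\int[mu]_(w in \bigcup_m B m) (enorm w `^ q)%:E < +oo)%E.
Proof.
move=> c0 rho1 mA JA mB ndB B0 BS.
set rho := c `^ _ in rho1.
have fge0 (w : 'rV[R]_n) : (0 <= (enorm w `^ q)%:E)%E by rewrite lee_fin powR_ge0.
pose J := fine (\int[mu]_(w in A) (enorm w `^ q)%:E).
have JE : (\int[mu]_(w in A) (enorm w `^ q)%:E = J%:E)%E.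
  by rewrite fineK// ge0_fin_numE// integral_ge0.
have J0 : 0 <= J by rewrite fine_ge0// integral_ge0.
(* [J / (1 - rho)] is the fixed point of t |-> J + rho t, so the bound is preserved by the
   recurrence. *)
have bound m : (\int[mu]_(w in B m) (enorm w `^ q)%:E <= (J / (1 - rho))%:E)%E.
  elim: m => [|m ih].
    by rewrite B0 integral_set0 lee_fin divr_ge0// subr_ge0 ltW.
  pose C := (fun w : 'rV[R]_n => c^-1 *: w + 0) @^-1` B m.
  have mC : measurable C by exact: measurable_affine_preimage.
  (* [A] and [C] may overlap; removing [A] from [C] makes the integral additive. *)
  apply: (@le_trans _ _ (\int[mu]_(w in A `|` (C `\` A)) (enorm w `^ q)%:E)%E).
    apply: ge0_subset_integral => //.
    - by apply: measurableU => //; exact: measurableD.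
    - exact: measurable_enorm_powR.
    - move=> w /BS[Aw|Bw]; first by left.
      have [Aw|nAw] := pselect (A w); first by left.
      by right; split => //; rewrite /C/= addr0.
  rewrite ge0_integral_setU//; last 3 first.
  - exact: measurableD.
  - exact: measurable_enorm_powR.
  - by apply/disj_set2P/seteqP; split => // w [? []].
  rewrite JE.
  apply: (@le_trans _ _ (J%:E + rho%:E * (J / (1 - rho))%:E)%E); last first.
    rewrite -EFinM -EFinD lee_fin le_eqVlt; apply/orP; left; apply/eqP.
    by field; rewrite subr_eq0 gt_eqF.
  apply: leeD => //.
  apply: (@le_trans _ _ (\int[mu]_(w in C) (enorm w `^ q)%:E)%E).
    apply: ge0_subset_integral => //; first exact: measurableD.
    exact: measurable_enorm_powR.
  have cV0 : c^-1 != 0 by rewrite invr_neq0// gt_eqF.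
  rewrite (eq_integral (fun w : 'rV[R]_n =>
    (c `^ q)%:E * (enorm (c^-1 *: w + 0) `^ q)%:E)%E); last first.
    move=> w _; rewrite addr0 enormZ gtr0_norm ?invr_gt0// -EFinM.
    rewrite -powRM ?mulr_ge0 ?invr_ge0 ?enorm_ge0 ?ltW//.
    by rewrite mulVKf// gt_eqF.
  rewrite ge0_integralZl//=; last 2 first.
  - apply: measurable_funTS; apply/measurable_EFinP.
    apply: (measurableT_comp (measurable_powR q)).
    by apply: (measurableT_comp measurable_enorm); exact: measurable_affine.
  - by rewrite lee_fin powR_ge0.
  rewrite (ge0_integral_affine c^-1 0 cV0 (B m) (fun w => (enorm w `^ q)%:E))//;
    last exact: measurable_enorm_powR.
  rewrite muleA -EFinM.
  (* The factor c^q comes from the homogeneity of the integrand, and c^n from the change of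
     variables. *)
  have -> : c `^ q * `|c^-1|^-1 ^+ n = rho.
    rewrite gtr0_norm ?invr_gt0// invrK -powR_mulrn ?ltW// /rho addrC powRD//.
    by rewrite (gt_eqF c0) implybT.
  by rewrite lee_pmul2l ?lte_fin ?powR_gt0.
apply: (@le_lt_trans _ _ (J / (1 - rho))%:E); last exact: ltry.
have cv := @ge0_nondecreasing_set_cvg_integral _ _ R B (fun w => (enorm w `^ q)%:E) mu ndB mB.
apply: (cvge_to_le (cv _ _)); last exact: nearW.
- by move=> m; exact: measurable_enorm_powR.
- by move=> m x _; exact: fge0.
Qed.

(** Self-similarity of ratio 2: beyond radius 2e, a point of one annulus of the exhaustion is twice
    a point of the preceding one, and 2^(n+q) < 1. *)
Lemma radial_powR_lty_infty q e : 0 < e -> n%:R + q < 0 ->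
  (\int[mu]_(w in [set w | (e < enorm w)%R]) (enorm w `^ q)%:E < +oo)%E.
Proof.
move=> e0 nq0.
have -> : [set w : 'rV[R]_n | e < enorm w] = \bigcup_m annulus e (2 ^+ m * e).
  apply/seteqP; split => [w /= ew|w [m _ []]//].
  exists (Num.truncn (enorm w / e)).+1 => //; split => //.
  rewrite -ler_pdivrMr// (le_trans (ltW (truncnS_gt _)))//.
  by rewrite -natrX ler_nat ltnW// ltn_expl.
apply: (@selfsimilar_powR_lty q 2 (annulus e (2 * e))) => //.
- by apply: powR_lt1; rewrite ?ltr1n.
- exact: measurable_annulus.
- by apply: annulus_powR_lty => //; apply: ler_peMl; [exact: ltW|rewrite ler1n].
- by move=> m; exact: measurable_annulus.
- move=> k m km; apply/subsetPset => w [ew wk]; split => //.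
  by rewrite (le_trans wk)// ler_pM2r// ler_weXn2l// ?ler1n.
- by apply/seteqP; split => // w [/lt_le_trans h /h]; rewrite expr0 mul1r ltxx.
- move=> m w [ew wm]; have [w2|w2] := leP (enorm w) (2 * e); first by left.
  right; rewrite /annulus /= enormZ gtr0_norm ?invr_gt0//.
  by rewrite ltr_pdivlMl// ler_pdivrMl// mulrA -exprS.
Qed.

(** Self-similarity of ratio 1/2, with annuli whose inner radius shrinks to 0; here it is
    (1/2)^(n+q) that is below 1. *)
Lemma radial_powR_lty_0 q r : 0 < r -> 0 < n%:R + q ->
  (\int[mu]_(w in annulus 0 r) (enorm w `^ q)%:E < +oo)%E.
Proof.
move=> r0 nq0.
have -> : annulus 0 r = \bigcup_m annulus (2^-1 ^+ m * r) r.
  apply/seteqP; split => [w /= [w0 wr]|w [m _ [mw wr]]]; last first.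
    by split => //; rewrite (lt_trans _ mw)// mulr_gt0// exprn_gt0.
  exists (Num.truncn (r / enorm w)).+1 => //; split => //.
  rewrite exprVn ltr_pdivrMl ?exprn_gt0// -ltr_pdivrMr//.
  by rewrite (lt_trans (truncnS_gt _))// -natrX ltr_nat ltn_expl.
apply: (@selfsimilar_powR_lty q 2^-1 (annulus (2^-1 * r) r)) => //.
- by rewrite -powR_inv1// -powRrM mulN1r powR_lt1 ?ltr1n// oppr_lt0.
- exact: measurable_annulus.
- apply: annulus_powR_lty; first by rewrite mulr_gt0.
  by apply: ler_piMl; [exact: ltW|rewrite invf_le1// ler1n].
- by move=> m; exact: measurable_annulus.
- move=> k m km; apply/subsetPset => w [kw wr]; split => //.
  by rewrite (le_lt_trans _ kw)// ler_pM2r// ler_wiXn2l ?invr_ge0// invf_le1 ?ler1n.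
- by apply/seteqP; split => // w [/lt_le_trans h /h]; rewrite expr0 mul1r ltxx.
- move=> m w [mw wr]; have [w2|w2] := ltP (2^-1 * r) (enorm w); first by left.
  right; rewrite /annulus /= enormZ invrK gtr0_norm//.
  by rewrite -ltr_pdivrMl// -ler_pdivlMl// mulrA -exprS.
Qed.

End radial.

(** * Integration along segments *)

(** The sigma-algebra is generated by coordinates, so openness must be reduced to countably many
    boxes: sup-norm balls with rational centres and radii 1/(k+1) are finite intersections of
    coordinate preimages. *)
Lemma open_measurable_rV {R : realType} {n : nat} (A : set 'rV[R]_n) :
  open A -> measurable A.
Proof.
move=> oA.
pose B (p : 'rV[rat]_n * nat) : set 'rV[R]_n :=
  ball (map_mx ratr p.1 : 'rV[R]_n) p.2.+1%:R^-1.
(* Balls that leave [A] are replaced by the empty set, which keeps the union indexed by a countable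
   type. *)
pose F p := if pselect (B p `<=` A) then B p else set0.
have -> : A = \bigcup_p F p.
  apply/seteqP; split => [x Ax|x [p _]]; last first.
    by rewrite /F; case: pselect => // BA /BA.
  have [e /= e0 eA] : \forall e \near 0^'+, ball x e `<=` A.
    move: oA; rewrite openE => /(_ _ Ax) /nbhs_ballP[e /= e0 eA].
    exists e => // t; rewrite /= sub0r normrN => te t0.
    apply: subset_trans eA; apply: le_ball.
    by move: te; rewrite gtr0_norm// => /ltW.
  (* A ball of radius below [d] that contains [x] lies in the ball of radius 2d = e/2 around [x];
     the inclusion [eA] is known only for radii strictly below [e]. *)
  pose d := e / 2 / 2.
  have d0 : 0 < d by rewrite !divr_gt0.
  have dA : ball x (d + d) `<=` A.
    apply: eA; last by rewrite addr_gt0.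
    rewrite /= sub0r normrN gtr0_norm ?addr_gt0// -splitr.
    by rewrite ltr_pdivrMr// ltr_pMr// ltr1n.
  pose k := Num.truncn d^-1.
  have kd : k.+1%:R^-1 < d.
    by rewrite invf_plt ?posrE// truncnS_gt.
  have k0 : 0 < k.+1%:R^-1 :> R by rewrite invr_gt0.
  have qP i : exists q : rat, ratr q \in `]x 0 i - k.+1%:R^-1, x 0 i + k.+1%:R^-1[.
    by apply: rat_in_itvoo; rewrite ltrBlDr -addrA ltrDl addr_gt0.
  pose q : 'rV[rat]_n := \row_i projT1 (cid (qP i)).
  have qx : ball x k.+1%:R^-1 (map_mx ratr q : 'rV[R]_n).
    split => // i j; rewrite !ord1 !mxE /ball /=.
    case: cid => /= r; rewrite in_itv/= => /andP[xr rx].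
    rewrite ltr_norml; move: (k.+1%:R^-1) (ratr r) xr rx => u v xr rx; lra.
  exists (q, k) => //; rewrite /F; case: pselect => /=; first by move=> _; exact: ball_sym.
  case=> z qz; apply: dA.
  have h1 := le_ball (ltW kd) qx; have h2 := le_ball (ltW kd) qz.
  exact: ball_triangle h1 h2.
apply: countable_bigcupT_measurable => [|p]; first exact: countableP.
rewrite /F; case: pselect => /= _; last exact: measurable0.
have -> : B p = \bigcap_(i in [set: 'I_n])
    ((fun x : 'rV[R]_n => x 0 i) @^-1` ball (ratr (p.1 0 i) : R) p.2.+1%:R^-1).
  apply/seteqP; split => [x [_ h] i _|x h] /=.
    by have := h 0 i; rewrite !mxE.
  split; first by rewrite invr_gt0.
  by move=> i j; rewrite !ord1 !mxE; exact: h.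
apply: fin_bigcap_measurable => // i _; rewrite -[X in measurable X]setTI.
by apply: measurable_coord => //; exact: measurable_ball.
Qed.

Lemma open_continuous_measurable_fun_rV {R : realType} {n : nat} (U : set 'rV[R]_n)
    (f : 'rV[R]_n -> R) :
  open U -> (forall x, U x -> {for x, continuous f}) -> measurable_fun U f.
Proof.
move=> oU cf; apply: (measurability _ (RGenOpens.measurableE R)).
move=> _ [_ [a [b ->] <-]]; apply: open_measurable_rV.
rewrite openE => x [Ux /= fx].
apply: filterI; first exact: open_nbhs_nbhs.
by apply: cf => //; apply: open_nbhs_nbhs; split => //; exact: interval_open.
Qed.

Lemma open_half_space {R : realType} {n : nat} : open (@half_space R n).
Proof.
apply: (open_comp _ (@open_gt R 0)) => x _; exact: coord_continuous.
Qed.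

(* No continuity at [T]: only the limit of the primitive there is known. *)
Lemma integral_deriv_itvoo {R : realType} (F f : R -> R) (T L C : R) : 0 < T ->
  (forall t, 0 <= t -> t < T -> is_derive t 1 F (f t)) ->
  (forall t, 0 <= t -> t < T -> {for t, continuous f}) ->
  (forall t, 0 <= t -> t < T -> `|f t| <= C) ->
  F t @[t --> T^'-] --> L ->
  \int[lebesgue_measure]_(t in `]0, T[) f t = L - F 0.
Proof.
move=> T0 dF cf fC FL.
have mf : measurable_fun `[0, T[ f.
  apply: subspace_continuous_measurable_fun => //.
  apply: continuous_in_subspaceT => t; rewrite inE/= in_itv/= => /andP[t0 tT].
  exact: cf.
have fi : (@lebesgue_measure R).-integrable `[0, T[ (EFin \o f).
  apply: measurable_bounded_integrable => //.
  - by rewrite /= lebesgue_measure_itv/= lte_fin T0 -EFinB ltry.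
  - exists C; split; first exact: num_real.
    move=> c Cc t; rewrite /= in_itv/= => /andP[t0 tT].
    by rewrite (le_trans _ (ltW Cc))// fC.
rewrite Rintegral_itv_obnd_cbnd; last first.
  by apply: integrableS fi => //; apply: subset_itvr; rewrite bnd_simp.
(* Extending [f] by 0 at [T] gives an integrable function on the closed interval, whose
   parameterized integral is left continuous at [T]. The fundamental theorem is then needed only on
   [0, x] with x < T. *)
pose g := f \_ `[0, T[.
have gi : (@lebesgue_measure R).-integrable `[0, T] (EFin \o g).
  rewrite -restrict_EFin; apply/integrable_restrict => //=.
  by rewrite setIidr//; apply: subset_itvl; rewrite bnd_simp.
have -> : \int[lebesgue_measure]_(t in `[0, T[) f t =
    \int[lebesgue_measure]_(t in `[0, T]) g t.
  rewrite Rintegral_mkcond [RHS]Rintegral_mkcond; congr (Rintegral _ _ _).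
  apply/funext => t; rewrite /g !patchE; case: ifPn => [tT|tT]; last by case: ifP.
  rewrite ifT//; move: tT; rewrite !inE/=; apply: subset_itvl.
  by rewrite bnd_simp.
rewrite -[LHS]/(parameterized_integral lebesgue_measure 0 T g).
have := parameterized_integral_cvg_at_left T0 gi.
move=> /cvg_lim <-//; apply: cvg_lim => //.
have : (F t - F 0) @[t --> T^'-] --> L - F 0 by apply: cvgB => //; exact: cvg_cst.
apply: cvg_trans; apply: near_eq_cvg; near=> x.
have x0 : 0 < x by near: x; exact: nbhs_left_gt.
have xT : x < T by near: x; exact: nbhs_left_lt.
have cF t : 0 <= t -> t < T -> {for t, continuous F}.
  move=> t0 tT; apply/differentiable_continuous/derivable1_diffP.
  by have [] := dF t t0 tT.
rewrite /parameterized_integral /=.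
transitivity (\int[lebesgue_measure]_(t in `[0, x]) f t); last first.
  apply: eq_Rintegral => t; rewrite inE/= in_itv/= => /andP[t0 tx].
  by rewrite /g patchE mem_set//= in_itv/= t0 (le_lt_trans tx).
rewrite /Rintegral (@continuous_FTC2 _ f F)//.
- apply: continuous_in_subspaceT => t; rewrite inE/= in_itv/= => /andP[t0 tx].
  by apply: cf => //; exact: le_lt_trans xT.
- split.
  + move=> t; rewrite in_itv/= => /andP[t0 tx].
    by have [] := dF t (ltW t0) (lt_trans tx xT).
  + by apply: cvg_at_right_filter; exact: cF.
  + by apply: cvg_at_left_filter; apply: cF => //; exact: ltW.
- move=> t; rewrite in_itv/= => /andP[t0 tx].
  by rewrite derive1E; have := dF t (ltW t0) (lt_trans tx xT) => ?; rewrite derive_val.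
Unshelve. all: by end_near. Qed.

Section segment_formula.
Context {R : realType}.

Lemma derive_dotv_grad {n} (f : 'rV[R]_n -> R) (z v : 'rV[R]_n) :
  differentiable f z -> 'D_v f z = dotv v (grad f z).
Proof.
move=> df; rewrite deriveE// [in LHS](row_sum_delta v) linear_sum.
by apply: eq_bigr => i _; rewrite linearZ mxE deriveE.
Qed.

Lemma is_derive_line {n} (f : 'rV[R]_n -> R) (x v : 'rV[R]_n) (t : R) :
  differentiable f (x + t *: v) ->
  is_derive t 1 (fun t : R => f (x + t *: v)) (dotv v (grad f (x + t *: v))).
Proof.
move=> df.
have quotE : (fun h : R => h^-1 *: (((fun t => f (x + t *: v)) \o shift t) (h *: 1) -
    f (x + t *: v))) =
    (fun h : R => h^-1 *: ((f \o shift (x + t *: v)) (h *: v) - f (x + t *: v))).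
  apply/funext => h /=; congr (_ *: (f _ - _)).
  by rewrite scalerDl addrCA; congr (_ *: _ + _); rewrite /GRing.scale/= mulr1.
apply: DeriveDef.
  by rewrite /derivable quotE; exact: diff_derivable.
by rewrite /derive quotE -derive_dotv_grad.
Qed.

Lemma cvg_dotv {n} {T : Type} {F : set_system T} {FF : Filter F}
    (v w : 'rV[R]_n) (f : T -> 'rV[R]_n) :
  f @ F --> w -> dotv v (f t) @[t --> F] --> dotv v w.
Proof.
move=> fw; apply: cvg_big => [|i _]; first exact: add_continuous.
apply: cvgM; first exact: cvg_cst.
apply: (@cvg_comp _ _ _ f (fun u : 'rV[R]_n => u 0 i) _ (nbhs w)) => //.
exact: coord_continuous.
Qed.

Lemma line_continuous {n} (x v : 'rV[R]_n) : continuous (fun t : R => x + t *: v).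
Proof.
by move=> t; apply: cvgD; [exact: cvg_cst|apply: scalel_continuous].
Qed.

Context {n : nat}.
Variables (psi : 'rV[R]_n.+1 -> R) (M : R).
Hypothesis psiC1 : C1 half_space psi.
Hypothesis psiM : forall z, half_space z -> enorm (grad psi z) <= M.

(** The half-space is convex, so the mean value theorem applies along the whole segment from [z] to
    [w]. *)
Lemma lipschitz_half_space (z w : 'rV[R]_n.+1) : half_space z -> half_space w ->
  `|psi w - psi z| <= M * enorm (w - z).
Proof.
move=> Oz Ow; pose v := w - z.
have Ol (t : R) : 0 <= t -> t <= 1 -> half_space (z + t *: v).
  move: Oz Ow; rewrite /half_space/= !mxE => z0 w0 t0 t1.
  have -> : z 0 ord_max + t * (w 0 ord_max - z 0 ord_max) =
    (1 - t) * z 0 ord_max + t * w 0 ord_max by ring.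
  have [->|tn0] := eqVneq t 0; first by rewrite subr0 mul1r mul0r addr0.
  by rewrite ltr_wpDl ?mulr_ge0 ?subr_ge0 ?(ltW z0)// mulr_gt0// lt_def tn0.
have dl (t : R) : 0 <= t -> t <= 1 ->
    is_derive t 1 (fun t : R => psi (z + t *: v)) (dotv v (grad psi (z + t *: v))).
  by move=> t0 t1; apply: is_derive_line; have [] := psiC1 _ (Ol t t0 t1).
have [] := @MVT_segment R (fun t : R => psi (z + t *: v))
    (fun t => dotv v (grad psi (z + t *: v))) 0 1 ler01.
- by move=> t; rewrite in_itv/= => /andP[/ltW t0 /ltW t1]; exact: dl.
- apply: derivable_within_continuous => t; rewrite in_itv/= => /andP[t0 t1].
  by have [] := dl t t0 t1.
- move=> t; rewrite in_itv/= => /andP[t0 t1].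
  have zv : z + v = w by rewrite addrC subrK.
  rewrite scale1r scale0r addr0 subr0 mulr1 zv => ->.
  rewrite (le_trans (dotv_le _ _))// mulrC ler_wpM2r ?enorm_ge0// psiM//.
  exact: Ol.
Qed.

(** Even a boundary point is approached from inside, by moving in the last coordinate direction.
    Properness is what makes the limit defining [boundary_value] meaningful. *)
Lemma within_half_space_proper (z : 'rV[R]_n.+1) : 0 <= z 0 ord_max ->
  ProperFilter (within half_space (nbhs z)).
Proof.
move=> z0; apply: Build_ProperFilter_ex => P zP.
have lz : (z + t *: delta_mx 0 ord_max) @[t --> (0 : R)^'+] --> z.
  apply: cvg_at_right_filter.
  by have := line_continuous z (delta_mx 0 ord_max) 0; rewrite /continuous_at scale0r addr0.
near (0 : R)^'+ => t.
have t0 : 0 < t by near: t; exact: nbhs_right_gt.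
exists (z + t *: delta_mx 0 ord_max).
have : half_space (z + t *: delta_mx 0 ord_max).
  by rewrite /half_space/= !mxE !eqxx/= mulr1 ltr_wpDl.
near: t; exact: (lz _ zP).
Unshelve. all: by end_near. Qed.

(** The Lipschitz bound makes the values of [psi] near [z] Cauchy, so completeness turns the [lim]
    of [boundary_value] into a genuine limit. *)
Lemma cvg_boundary_value (z : 'rV[R]_n.+1) : 0 <= z 0 ord_max ->
  psi y @[y --> within half_space (nbhs z)] --> boundary_value psi z.
Proof.
move=> z0; have PF := within_half_space_proper z z0.
rewrite /boundary_value -/(cvg _).
apply/cauchy_cvgP/cauchy_exP => e e0.
have M0 : 0 <= `|M| + 1 by rewrite addr_ge0.
(* Two points of a sup-norm ball of radius [d] are at Euclidean distance less than (n+1) 2d, and [d]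
   makes (|M| + 1) (n+1) 2d equal to [e]. The 1 keeps the divisor positive. *)
pose d := e / ((`|M| + 1) * n.+1%:R) / 2.
have d0 : 0 < d by rewrite !divr_gt0// mulr_gt0// ltr_wpDl.
have near_ball : within half_space (nbhs z) (half_space `&` ball z d).
  by apply: filterS (nbhsx_ballx z d d0) => y; split.
have [w [Ow zw]] := filter_ex near_ball.
exists (psi w); rewrite /nbhs/=.
apply: filterS near_ball => y [Oy zy]; rewrite /ball/=.
rewrite (le_lt_trans (lipschitz_half_space _ _ Oy Ow))//.
have : enorm (w - y) < n.+1%:R * (d + d).
  rewrite (le_lt_trans (enorm_le_sum _))//.
  have -> : n.+1%:R * (d + d) = \sum_(i < n.+1) (d + d).
    by rewrite sumr_const card_ord mulr_natl.
  apply: ltr_sum => [|i _]; first by apply/hasP; exists ord0; rewrite ?mem_index_enum.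
  rewrite !mxE; move: zw zy => [_ /(_ 0 i) zw] [_ /(_ 0 i) zy].
  move: zw zy; rewrite /ball/= => zw zy.
  rewrite (_ : _ - _ = (z 0 i - y 0 i) - (z 0 i - w 0 i)); last by ring.
  by rewrite (le_lt_trans (ler_normB _ _))// ltrD.
move=> wy; apply: (@le_lt_trans _ _ ((`|M| + 1) * enorm (w - y))).
  by rewrite ler_wpM2r ?enorm_ge0// (le_trans (ler_norm _))// lerDl.
apply: (lt_le_trans (y := (`|M| + 1) * (n.+1%:R * (d + d)))).
  by rewrite ltr_pM2l// ltr_wpDl.
rewrite /d -splitr !mulrA mulrAC mulfV ?mul1r//.
Qed.

Lemma extension_integral (x y : 'rV[R]_n.+1) : half_space x ->
  extension psi y (y - x) - psi x =
  \int[lebesgue_measure]_(t in `]0, 1[)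
    (if x + t *: (y - x) \in half_space then
       dotv (y - x) (grad psi (x + t *: (y - x))) else 0).
Proof.
move=> Ox; pose v := y - x; rewrite -/v.
pose f (t : R) := dotv v (grad psi (x + t *: v)).
(* [T] is the time, at most 1, up to which the segment stays in the half-space, and [L] the limit of
   [psi] there. Both branches of [extension] are instances: T = 1 with L = psi y, or the exit time
   with the boundary value. *)
have key (T L : R) : 0 < T -> T <= 1 ->
    (forall t : R, 0 <= t -> t < 1 -> (half_space (x + t *: v) <-> t < T)) ->
    psi (x + t *: v) @[t --> T^'-] --> L ->
    L - psi x = \int[lebesgue_measure]_(t in `]0, 1[)
      (if x + t *: v \in half_space then f t else 0).
  move=> T0 T1 OT cL.
  have -> : psi x = psi (x + 0 *: v) by rewrite scale0r addr0.
  transitivity (\int[lebesgue_measure]_(t in `]0, T[) f t).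
    apply/esym.
    apply: (@integral_deriv_itvoo _ (fun t : R => psi (x + t *: v)) f T L (enorm v * M)) => //.
    - move=> t t0 tT; apply: is_derive_line.
      by apply: (psiC1 _ _).1; apply/OT => //; exact: lt_le_trans T1.
    - move=> t t0 tT; apply: cvg_dotv.
      apply: (@cvg_comp _ _ _ (fun t => x + t *: v) (grad psi) _ (nbhs (x + t *: v))).
        exact: line_continuous.
      by apply: (psiC1 _ _).2; apply/OT => //; exact: lt_le_trans T1.
    - move=> t t0 tT; rewrite (le_trans (dotv_le _ _))// ler_wpM2l ?enorm_ge0// psiM//.
      by apply/OT => //; exact: lt_le_trans T1.
  rewrite Rintegral_mkcond [RHS]Rintegral_mkcond; congr (Rintegral _ _ _).
  apply/funext => t; rewrite !patchE; case: ifPn => tT.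
    have := tT; rewrite inE/= in_itv/= => /andP[t0 tlt].
    rewrite !mem_set//=; last by rewrite in_itv/= t0 (lt_le_trans tlt).
    by apply/OT => //; [exact: ltW|exact: lt_le_trans T1].
  case: ifPn => //; rewrite inE/= in_itv/= => /andP[t0 t1].
  rewrite ifF//; apply/negbTE; apply: contra tT; rewrite !inE/= in_itv/= t0/=.
  by move=> /OT; apply => //; exact: ltW.
have x0 : 0 < x 0 ord_max := Ox.
rewrite /extension; case: ltP => y0.
- apply: (key 1 (psi y)) => //.
    move=> t t0 t1; split => // _; rewrite /half_space/= !mxE.
    have -> : x 0 ord_max + t * (y 0 ord_max - x 0 ord_max) =
      (1 - t) * x 0 ord_max + t * y 0 ord_max by ring.
    by rewrite ltr_wpDr ?mulr_ge0 ?(ltW y0)// mulr_gt0// subr_gt0.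
  apply: cvg_at_left_filter.
  rewrite (_ : psi y = psi (x + 1 *: v)); last by rewrite scale1r /v addrC subrK.
  apply: (@cvg_comp _ _ _ (fun t => x + t *: v) psi _ (nbhs (x + 1 *: v))).
    exact: line_continuous.
  have Ol : half_space (x + 1 *: v) by rewrite scale1r /v addrC subrK.
  exact: (differentiable_continuous (psiC1 _ Ol).1).
- have d0 : 0 < x 0 ord_max - y 0 ord_max by rewrite subr_gt0 (le_lt_trans y0).
  (* The zero of the last coordinate along the segment; if y_N = 0 it equals 1 and the hit point is
     [y] itself. *)
  pose T := x 0 ord_max / (x 0 ord_max - y 0 ord_max).
  have OT (t : R) : half_space (x + t *: v) <-> t < T.
    rewrite /half_space/= !mxE /T ltr_pdivlMr//.
    have -> : x 0 ord_max + t * (y 0 ord_max - x 0 ord_max) =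
      x 0 ord_max - t * (x 0 ord_max - y 0 ord_max) by ring.
    by rewrite subr_gt0.
  have T0 : 0 < T by rewrite divr_gt0.
  have hitE : hit_point y v = x + T *: v.
    apply/rowP => i; rewrite !mxE; case: eqP => [->|_].
      by rewrite /T; field; rewrite gt_eqF.
    rewrite /T; field; rewrite gt_eqF//=.
    by rewrite -opprB oppr_eq0 gt_eqF.
  apply: (key T) => //.
    by rewrite ler_pdivrMr// mul1r lerBrDr gerDl.
  have zN : (x + T *: v) 0 ord_max = 0.
    by rewrite !mxE /T; field; rewrite gt_eqF.
  rewrite hitE; have zN0 : 0 <= (x + T *: v) 0 ord_max by rewrite zN.
  apply: (@cvg_comp _ _ _ (fun t => x + t *: v) psi _ _ _ _ (cvg_boundary_value _ zN0)).
  (* Before time [T] the segment is inside the half-space, so it converges to the hit point along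
     the filter [within half_space]. *)
  have lz := cvg_at_left_filter (line_continuous x v T).
  move=> P zP; change (\forall t \near T^'-, P (x + t *: v)); near=> t.
  have : half_space (x + t *: v) by apply/OT; near: t; exact: nbhs_left_lt.
  near: t; exact: (lz _ zP).
Unshelve. all: by end_near. Qed.

End segment_formula.

(** * Fubini along dilations *)

Section radial_kernel.
Context {R : realType} {n : nat}.
Notation mu := (lebesgue_rV n.+1 : {measure set 'rV[R]_n.+1 -> \bar R}).
Implicit Types (x y v w : 'rV[R]_n.+1) (s e : R).

Lemma measurable_sub x i : measurable_fun setT (fun y : 'rV[R]_n.+1 => (y - x) 0 i).
Proof.
under eq_fun do rewrite !mxE.
by apply: measurable_funB => //; exact: measurable_coord.
Qed.

Lemma measurable_enorm_sub x : measurable_fun setT (fun y : 'rV[R]_n.+1 => enorm (y - x)).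
Proof.
apply: measurableT_comp; first exact: measurable_enorm.
by apply: measurable_rV => i; exact: measurable_sub.
Qed.

Lemma measurable_kernel s x : measurable_fun setT (fun y => Defs.kernel s (y - x) : R).
Proof.
rewrite /Defs.kernel; under eq_fun do rewrite -powRN.
by apply: (measurableT_comp (measurable_powR _)); exact: measurable_enorm_sub.
Qed.

Lemma measurable_pv_dom (D : set 'rV[R]_n.+1) x e : measurable D -> measurable (pv_dom D x e).
Proof.
move=> mD; apply: measurableI => //.
rewrite [X in measurable X](_ : _ = setT `&` ((fun y => enorm (y - x)) @^-1` `]e, +oo[)).
  exact: measurable_enorm_sub.
by rewrite setTI; apply/seteqP; split => w /=; rewrite in_itv/= andbT.
Qed.

Lemma kernel_ge0 s v : 0 <= Defs.kernel s v.
Proof. by rewrite invr_ge0 powR_ge0. Qed.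

Lemma enorm_kernel s v : 0 < enorm v ->
  enorm (Defs.kernel s v *: v) = enorm v `^ (1 - (n.+1%:R + 2 * s)).
Proof.
move=> v0; rewrite enormZ ger0_norm ?kernel_ge0// powRB; last by apply/implyP => _; rewrite gt_eqF.
by rewrite powRr1 ?ltW// mulrC.
Qed.

Lemma kernelZ s (c : R) v : 0 < c ->
  Defs.kernel s (c *: v) = c `^ (- (n.+1%:R + 2 * s)) * Defs.kernel s v.
Proof.
move=> c0; rewrite /Defs.kernel enormZ gtr0_norm// powRM ?enorm_ge0 ?ltW//.
by rewrite invfM powRN.
Qed.

(** Puts the dilation about [x] in the form [a *: y + b] of the change of variables. *)
Lemma affine_sub (c : R) x y : x + c *: (y - x) = c *: y + (x - c *: x).
Proof. by rewrite scalerBr addrCA. Qed.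

Lemma scale1_affine x : (fun y => 1 *: y + - x) = (fun y => y - x).
Proof. by apply/funext => y; rewrite scale1r. Qed.

Lemma integrable_radial_infty x e (q : R) : 0 < e -> n.+1%:R + q < 0 ->
  mu.-integrable (pv_dom setT x e) (fun y => (enorm (y - x) `^ q)%:E).
Proof.
move=> e0 q0.
have h : mu.-integrable [set w : 'rV[R]_n.+1 | e < enorm w]
    (EFin \o (fun w => enorm w `^ q)).
  apply/integrableP; split; first exact: measurable_enorm_powR.
  under eq_integral do rewrite gee0_abs ?lee_fin ?powR_ge0//.
  exact: radial_powR_lty_infty.
have := @integrable_affine R n.+1 1 (- x) (oner_neq0 _) _ _ (measurable_enorm_gt e) h.
by rewrite scale1_affine /pv_dom setTI.
Qed.

Lemma integrable_radial_0 x r (q : R) : 0 < r -> 0 < n.+1%:R + q ->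
  mu.-integrable [set y | annulus 0 r (y - x)] (fun y => (enorm (y - x) `^ q)%:E).
Proof.
move=> r0 q0.
have h : mu.-integrable (annulus 0 r) (EFin \o (fun w : 'rV[R]_n.+1 => enorm w `^ q)).
  apply/integrableP; split; first exact: measurable_enorm_powR.
  under eq_integral do rewrite gee0_abs ?lee_fin ?powR_ge0//.
  exact: radial_powR_lty_0.
have := @integrable_affine R n.+1 1 (- x) (oner_neq0 _) _ _ (measurable_annulus 0 r) h.
by rewrite scale1_affine.
Qed.

End radial_kernel.

Section indicator.
Context {d} {T : measurableType d} {R : realType}.
Variables (m : {measure set T -> \bar R}) (D : set T) (f : T -> R).

Lemma restrict_indicE :
  (EFin \o f) \_ D = (fun y => (\1_D y * f y)%:E).
Proof.
apply/funext => y; rewrite patchE indicE; case: ifPn => _; first by rewrite mul1r.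
by rewrite mul0r.
Qed.

Lemma integral_mkindic :
  (\int[m]_(y in D) (f y)%:E = \int[m]_y (\1_D y * f y)%:E)%E.
Proof. by rewrite integral_mkcond restrict_indicE. Qed.

Lemma integrable_mkindic : measurable D ->
  m.-integrable D (EFin \o f) <-> m.-integrable setT (fun y => (\1_D y * f y)%:E).
Proof. by move=> mD; rewrite -restrict_indicE; exact: integrable_mkcond. Qed.

End indicator.

Section fubini_dilation.
Context {R : realType} {n : nat}.
Notation mu := (lebesgue_rV n.+1 : {measure set 'rV[R]_n.+1 -> \bar R}).
Notation lam := (@lebesgue_measure R).
Variables (s M : R) (g : 'rV[R]_n.+1 -> 'rV[R]_n.+1) (x : 'rV[R]_n.+1).
Hypothesis s_gt : 1 < 2 * s.
Hypothesis mg : forall i, measurable_fun setT (fun z => g z 0 i).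
Hypothesis gM : forall z, enorm (g z) <= M.

Let M0 : 0 <= M. Proof. exact: le_trans (enorm_ge0 _) (gM 0). Qed.
(** The degree of homogeneity of [kernel s v *: v]. Since N + q = 1 - 2s < 0, the power of degree
    [q] is integrable at infinity. *)
Let q : R := 1 - (n.+1%:R + 2 * s).
Let q_lt : n.+1%:R + q < 0. Proof. by rewrite /q addrCA opprD addNKr; move: s_gt; lra. Qed.
Let E (e : R) := pv_dom setT x e.
Let mE e : measurable (E e). Proof. by apply: measurable_pv_dom. Qed.
Let d (t : R) (y : 'rV[R]_n.+1) : R := dotv (y - x) (g (x + t *: (y - x))).

Lemma measurable_field_integrand : measurable_fun setT
  (fun y : 'rV[R]_n.+1 => dotv (Defs.kernel s (y - x) *: (y - x)) (g y)).
Proof.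
apply: measurable_dotv => i //; under eq_fun do rewrite mxE.
by apply: measurable_funM; [exact: measurable_kernel|exact: measurable_sub].
Qed.

Lemma field_integrand_integrable e : 0 < e ->
  mu.-integrable (pv_dom setT x e)
    (EFin \o (fun y : 'rV[R]_n.+1 => dotv (Defs.kernel s (y - x) *: (y - x)) (g y))).
Proof.
move=> e0.
apply: (le_integrable (mE e) _ _
  (integrableZl (mE e) M (integrable_radial_infty x e q e0 q_lt))).
  by apply/measurable_EFinP; apply: measurable_funTS; exact: measurable_field_integrand.
move=> y [_ ey]; rewrite -EFinM !abse_EFin lee_fin (le_trans (dotv_le _ _))//.
rewrite enorm_kernel ?(lt_trans e0)// mulrC [leRHS]ger0_norm ?mulr_ge0 ?powR_ge0//.
by rewrite ler_wpM2r ?powR_ge0.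
Qed.

Let measurable_d : measurable_fun setT (fun z : R * 'rV[R]_n.+1 => d z.1 z.2).
Proof.
have m2 i : measurable_fun setT (fun z : R * 'rV[R]_n.+1 => (z.2 - x) 0 i).
  by apply: (measurableT_comp (measurable_sub x i)); exact: measurable_snd.
apply: measurable_dotv => // i.
apply: (measurableT_comp (mg i)); apply: measurable_rV => j.
under eq_fun do rewrite mxE.
apply: measurable_funD => //; under eq_fun do rewrite mxE.
by apply: measurable_funM => //; exact: measurable_fst.
Qed.

Variable e : R.
Hypothesis e0 : 0 < e.

Let I : set R := `]0, 1[.
Let mI : measurable (I : set (measurableTypeR R)). Proof. exact: measurable_itv. Qed.
Let lamI : lam I = 1%E.
Proof. by rewrite /I lebesgue_measure_itv/= lte_fin ltr01 -EFinB subr0. Qed.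
(** A majorant of the double integrand that does not depend on the time [t]. *)
Let k (y : 'rV[R]_n.+1) : R := \1_(E e) y * (M * enorm (y - x) `^ q).
(** The indicators carry the domains, so that Fubini runs on the full product. Integration in [t]
    yields the jump side, integration in [y] the gradient side. *)
Let h (z : R * 'rV[R]_n.+1) : R :=
  \1_I z.1 * (\1_(E e) z.2 * (d z.1 z.2 * Defs.kernel s (z.2 - x))).

Let measurable_h : measurable_fun setT h.
Proof.
apply: measurable_funM.
  by apply: (measurableT_comp (measurable_indic mI)); exact: measurable_fst.
apply: measurable_funM.
  by apply: (measurableT_comp (measurable_indic (mE e))); exact: measurable_snd.
apply: measurable_funM; first exact: measurable_d.
by apply: (measurableT_comp (measurable_kernel s x)); exact: measurable_snd.
Qed.

Let k_ge0 y : 0 <= k y.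
Proof. by rewrite /k mulr_ge0// ?indicE// mulr_ge0// powR_ge0. Qed.

Let h_le z : `|h z| <= \1_I z.1 * k z.2.
Proof.
rewrite /h /k normrM ger0_norm ?indicE// ler_wpM2l//.
rewrite normrM ger0_norm ?indicE//.
case: (boolP (z.2 \in E e)) => [|_]; last by rewrite !mul0r.
rewrite inE => -[_ ez]; rewrite !mul1r normrM.
have z0 : 0 < enorm (z.2 - x) by exact: lt_trans ez.
rewrite -(enorm_kernel s _ z0) enormZ (ger0_norm (kernel_ge0 _ _)) mulrCA mulrC.
rewrite ler_wpM2l ?kernel_ge0// (le_trans (dotv_le _ _))// mulrC.
by rewrite ler_wpM2r ?enorm_ge0.
Qed.

Let k_integrable : mu.-integrable setT (EFin \o k).
Proof.
apply/(integrable_mkindic _ (E e)); first exact: mE.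
exact: (integrableZl (mE e) M (integrable_radial_infty x e q e0 q_lt)).
Qed.

Let mus := @lebesgue_rVs R n.+1.

Let dom_integrable : (lam \x mus)%E.-integrable setT (fun z => (\1_I z.1 * k z.2)%:E).
Proof.
have m1 : measurable_fun setT (fun z : R * 'rV[R]_n.+1 => (\1_I z.1 * k z.2)%:E).
  apply/measurable_EFinP; apply: measurable_funM.
    by apply: (measurableT_comp (measurable_indic mI)); exact: measurable_fst.
  have /measurable_EFinP mk := measurable_int _ k_integrable.
  by apply: (measurableT_comp mk); exact: measurable_snd.
apply/integrable12ltyP => //.
have kfin : (\int[mus]_y (k y)%:E \is a fin_num)%E.
  by have := integrable_fin_num measurableT k_integrable.
have inner t : (\int[mus]_y `|(\1_I t * k y)%:E| = (\1_I t)%:E * \int[mus]_y (k y)%:E)%E.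
  have i0 : 0 <= \1_I t :> R by rewrite indicE.
  have mk : measurable_fun setT (EFin \o k) by have := measurable_int _ k_integrable.
  rewrite -ge0_integralZl//; last by move=> y _; rewrite lee_fin.
  by apply: eq_integral => y _; rewrite -EFinM gee0_abs// lee_fin mulr_ge0.
under eq_integral do rewrite inner.
rewrite ge0_integralZr//.
- rewrite integral_indic// setIT -[X in (X * _)%E]/(lam I) lamI mul1e.
  by rewrite ltey_eq kfin.
- by apply/measurable_EFinP; exact: measurable_indic.
- by apply: (@integral_ge0 _ _ _ mu) => y _; rewrite lee_fin.
Qed.

Let h_integrable : (lam \x mus)%E.-integrable setT (EFin \o h).
Proof.
apply: le_integrable dom_integrable => //; first exact/measurable_EFinP.
move=> z _; rewrite /= lee_fin [leRHS]ger0_norm ?h_le//.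
by rewrite mulr_ge0 ?indicE.
Qed.

Let d_integrable y : lam.-integrable I (EFin \o (d ^~ y)).
Proof.
have md : measurable_fun setT (d ^~ y).
  have mp : measurable_fun setT (fun t : R => (t, y)).
    by apply: measurable_fun_pair; [exact: measurable_id|exact: measurable_cst].
  exact: (measurableT_comp measurable_d mp).
apply: measurable_bounded_integrable => //.
- by rewrite /= [ltLHS]lamI ltry.
- exact: measurable_funTS.
- exists (enorm (y - x) * M); split; first exact: num_real.
  move=> c Cc t _ /=; rewrite (le_trans _ (ltW Cc))// (le_trans (dotv_le _ _))//.
  by rewrite ler_wpM2l ?enorm_ge0.
Qed.

Let U (y : 'rV[R]_n.+1) : R := (\int[lam]_(t in I) d t y) * Defs.kernel s (y - x).

Let integral_h_dt y : (\int[lam]_t (h (t, y))%:E = (\1_(E e) y * U y)%:E)%E.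
Proof.
transitivity (\int[lam]_t ((\1_(E e) y * Defs.kernel s (y - x))%:E * (\1_I t * d t y)%:E))%E.
  by apply: eq_integral => t _; rewrite -EFinM /h /=; congr EFin; ring.
rewrite integralZl//; last exact: ((integrable_mkindic lam I (d ^~ y) mI).1 (d_integrable y)).
rewrite -(integral_mkindic lam I (d ^~ y)) -[X in (_ * X)%E]fineK; last first.
  exact: integrable_fin_num (d_integrable y).
by rewrite -EFinM /U /Rintegral; congr EFin; ring.
Qed.

Lemma segment_integrable : mu.-integrable (pv_dom setT x e)
  (EFin \o (fun y : 'rV[R]_n.+1 =>
    (\int[lam]_(t in `]0, 1[) dotv (y - x) (g (x + t *: (y - x)))) * Defs.kernel s (y - x))).
Proof.
apply/(integrable_mkindic _ (E e)); first exact: mE.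
apply: le_integrable k_integrable => //.
  (* Measurability in [y] of the inner integral is a by-product of Fubini for [h]. *)
  have := measurable_fubini_G h_integrable.
  by congr measurable_fun; apply/funext => y; exact: integral_h_dt.
move=> y _; rewrite -/(U y) -integral_h_dt.
have mhy : measurable_fun setT (fun t : R => (h (t, y))%:E).
  have mp : measurable_fun setT (fun t : R => (t, y)).
    by apply: measurable_fun_pair; [exact: measurable_id|exact: measurable_cst].
  by apply/measurable_EFinP; exact: (measurableT_comp measurable_h mp).
apply: (@le_trans _ _ (\int[lam]_t `|(h (t, y))%:E|)%E).
  exact: le_abse_integral.
have -> : `|(EFin \o k) y|%E = (\int[lam]_t (k y * \1_I t)%:E)%E.
  under eq_integral do rewrite EFinM.
  rewrite ge0_integralZl//.
  - rewrite integral_indic// setIT -[X in (_ * X)%E]/(lam I) lamI mule1.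
    by rewrite gee0_abs ?lee_fin.
  - by apply/measurable_EFinP; exact: measurable_indic.
  - by rewrite lee_fin.
apply: ge0_le_integral => //.
- exact: measurableT_comp.
- apply/measurable_EFinP; apply: measurable_funM => //; exact: measurable_indic.
- by move=> t _; rewrite abse_EFin lee_fin mulrC h_le.
Qed.

Let G (r : R) : R := \int[mu]_(y in pv_dom setT x r)
  dotv (Defs.kernel s (y - x) *: (y - x)) (g y).

(** For z = x + t (y - x), the integrand is t^(N+2s-1) times the field integrand at z: the kernel
    contributes t^(N+2s), and y - x = (z - x)/t takes one power away. The change of variables
    contributes t^(-N), whence the weight t^(2s-1). *)
Let integral_h_dy t : (\int[mus]_y (h (t, y))%:E =
  (\1_I t * (t `^ (2 * s - 1) * G (t * e)))%:E)%E.
Proof.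
have [tI|tI] := boolP (t \in I); last first.
  rewrite [RHS](_ : _ = 0%E); last by rewrite indicE (negbTE tI) mul0r.
  by apply: integral0_eq => y _; rewrite /h /= indicE (negbTE tI) mul0r.
have t0 : 0 < t by move/set_mem: tI; rewrite /I/= in_itv/= => /andP[].
have tn0 : t != 0 by rewrite gt_eqF.
pose G0 (y : 'rV[R]_n.+1) := dotv (Defs.kernel s (y - x) *: (y - x)) (g y).
pose phi (y : 'rV[R]_n.+1) := t *: y + (x - t *: x).
have phiE y : phi y = x + t *: (y - x) by rewrite affine_sub.
have phiB y : phi y - x = t *: (y - x) by rewrite phiE [LHS]addrC addKr.
have Ephi : phi @^-1` E (t * e) = E e.
  apply/seteqP; split => y [_ ey]; split => //; move: ey;
    by rewrite /= phiB enormZ gtr0_norm// ltr_pM2l.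
have te0 : 0 < t * e by rewrite mulr_gt0.
have iG := integrable_affine t (x - t *: x) tn0 _ _ (mE _) (field_integrand_integrable _ te0).
transitivity (\int[mu]_(y in E e) (t `^ (n.+1%:R + 2 * s - 1) * G0 (phi y))%:E)%E.
  rewrite [RHS]integral_mkindic; apply: eq_integral => y _.
  rewrite /h /= [\1_I t]indicE tI mul1r; congr (_ * _)%:E.
  rewrite /G0 phiB phiE kernelZ// /d !dotvZl.
  rewrite powRN [in RHS]powRB; last by apply/implyP => _.
  rewrite powRr1 ?ltW//; field.
  by rewrite gt_eqF// powR_gt0.
have mphi := measurable_affine_preimage t (x - t *: x) _ (mE (t * e)).
have f1i : mu.-integrable (phi @^-1` E (t * e))
    (EFin \o (fun y => t `^ (n.+1%:R + 2 * s - 1) * G0 (phi y))).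
  exact: (integrableZl mphi _ iG).
rewrite -Ephi -[LHS]fineK; last exact: (integrable_fin_num mphi f1i).
rewrite -/(Rintegral _ _ (fun y => t `^ (n.+1%:R + 2 * s - 1) * G0 (phi y))).
rewrite RintegralZl//.
rewrite (Rintegral_affine t _ tn0 _ _ (mE _) (field_integrand_integrable _ te0)).
rewrite indicE tI mul1r mulrA; congr (_ * _)%:E.
rewrite gtr0_norm// -powR_inv1 ?ltW// -powR_mulrn ?powR_ge0// -powRrM -powRD; last first.
  by apply/implyP.
by congr (_ `^ _); ring.
Qed.

Lemma dilation_integrable :
  lam.-integrable `]0, 1[ (EFin \o (fun t : R => t `^ (2 * s - 1) * G (t * e))).
Proof.
apply: (integrable_mkindic lam I (fun t => t `^ (2 * s - 1) * G (t * e)) mI).2.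
have := integrable_fubini_F h_integrable.
by congr (lam.-integrable _ _); apply/funext => y; exact: integral_h_dy.
Qed.

Lemma segment_dilation :
  \int[mu]_(y in pv_dom setT x e)
    ((\int[lam]_(t in `]0, 1[) dotv (y - x) (g (x + t *: (y - x)))) *
      Defs.kernel s (y - x)) =
  \int[lam]_(t in `]0, 1[) (t `^ (2 * s - 1) * G (t * e)).
Proof.
rewrite /Rintegral; congr fine.
rewrite [LHS]integral_mkindic [RHS]integral_mkindic.
transitivity (\int[mu]_y \int[lam]_t (h (t, y))%:E)%E.
  by apply: eq_integral => y _; rewrite integral_h_dt.
rewrite -(Fubini h_integrable).
by apply: eq_integral => t _; rewrite [LHS]integral_h_dy.
Qed.

End fubini_dilation.

(** * One-dimensional integrals *)

Section one_dimensional.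
Context {R : realType}.
Notation lam := (@lebesgue_measure R).

(** A positive exponent keeps the integrand continuous at 0, so the fundamental theorem applies on
    the closed interval. *)
Lemma integral_powR (a T : R) : 0 < a -> 0 < T ->
  (\int[lam]_(u in `]0%R, T[) (u `^ a)%:E = (T `^ (a + 1) / (a + 1))%:E)%E.
Proof.
move=> a0 T0.
have a10 : 0 < a + 1 by rewrite addr_gt0.
have cpow (b u : R) : 0 < u -> {for u, continuous (fun u => u `^ b)}.
  move=> u0; apply/differentiable_continuous/derivable1_diffP.
  by apply: derivable_powR; rewrite in_itv/= u0.
have cpow0 (b : R) : 0 < b -> u `^ b @[u --> (0:R)^'+] --> (0 : R) `^ b.
  by move=> b0; rewrite powR0 ?gt_eqF//; exact: powR_cvg0.
rewrite integral_itv_obnd_cbnd; last first.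
  by apply: measurable_funTS; apply/measurable_EFinP; exact: measurable_powR.
rewrite integral_itv_bndo_bndc; last first.
  by apply: measurable_funTS; apply/measurable_EFinP; exact: measurable_powR.
pose F (u : R) := (a + 1)^-1 *: u `^ (a + 1).
have dF (u : R) : 0 < u -> is_derive u 1 F (u `^ a).
  move=> u0; have h := is_derive1_powR (a + 1) u0; apply: DeriveDef.
    by apply: derivableZ; have [] := h.
  rewrite deriveZ; last by have [] := h.
  by rewrite derive_val addrK /GRing.scale/= mulrA mulVf ?mul1r// gt_eqF.
have cF (u : R) : 0 < u -> {for u, continuous F}.
  by move=> /dF[h _]; apply/differentiable_continuous/derivable1_diffP.
rewrite (@continuous_FTC2 _ (fun u => u `^ a) F)//.
- by rewrite -EFinB /F powR0 ?gt_eqF// scaler0 subr0 /GRing.scale/= mulrC.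
- apply/continuous_within_itvP => //; split.
  + by move=> u; rewrite in_itv/= => /andP[u0 _]; exact: cpow.
  + exact: cpow0.
  + by apply: cvg_at_left_filter; exact: cpow.
- split.
  + by move=> u; rewrite in_itv/= => /andP[u0 _]; have [] := dF u u0.
  + by apply: cvgZl_tmp; exact: cpow0.
  + by apply: cvg_at_left_filter; exact: cF.
- by move=> u; rewrite in_itv/= => /andP[/dF[_ h] _]; rewrite derive1E.
Qed.

Lemma integral_expRN (u : R) : (\int[lam]_(t in `]u, +oo[) (expR (- t))%:E = (expR (- u))%:E)%E.
Proof.
have me : measurable_fun setT (fun t : R => expR (- t)).
  exact: (measurableT_comp (@measurable_expR R)).
rewrite integral_itv_obnd_cbnd; last by apply: measurable_funTS; apply/measurable_EFinP.
have de (t : R) : is_derive t 1 (fun t => - expR (- t)) (expR (- t)).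
  by apply: is_derive_eq; rewrite /= mulrN1 opprK.
have ce : continuous (fun t : R => expR (- t)).
  move=> t; apply: continuous_comp; [exact: opp_continuous|exact: continuous_expR].
rewrite (@ge0_continuous_FTC2y _ _ (fun t => - expR (- t)) u 0)//.
- by rewrite -EFinB sub0r opprK.
- by apply: continuous_subspaceT.
- by rewrite -oppr0; apply: cvgN; exact: cvgr_expR.
- by apply: cvg_at_right_filter; apply: cvgN; exact: ce.
- by move=> t _; rewrite derive1E derive_val.
Qed.

(* Tonelli for [z u^(z-1) e^(-t)] on the set [0 < u < t]. *)
Lemma GammaD1 (z : R) : 1 < z -> Gamma (z + 1) = z * Gamma z.
Proof.
move=> z1; have z0 : 0 < z by exact: lt_trans z1.
pose A : set (R * R) := [set p | 0 < p.2] `&` [set p | 0 < p.1 - p.2].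
pose c (u : R) : R := z * u `^ (z - 1).
pose f (p : R * R) : R := \1_A p * (c p.2 * expR (- p.1)).
have c0 u : 0 <= c u by rewrite mulr_ge0 ?powR_ge0 ?ltW.
have m1 : measurable_fun setT (fun p : R * R => p.1) by exact: measurable_fst.
have m2 : measurable_fun setT (fun p : R * R => p.2) by exact: measurable_snd.
have mpos (h : R * R -> R) : measurable_fun setT h -> measurable [set p | 0 < h p].
  move=> mh; rewrite [X in measurable X](_ : _ = setT `&` (h @^-1` `]0, +oo[)).
    by apply: mh.
  by rewrite setTI; apply/seteqP; split => p /=; rewrite in_itv/= andbT.
have mA : measurable A.
  by apply: measurableI; apply: mpos => //; exact: measurable_funB.
have me : measurable_fun setT (fun t : R => expR (- t)).
  exact: (measurableT_comp (@measurable_expR R)).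
have mc : measurable_fun setT c by apply: measurable_funM => //; exact: measurable_powR.
have mf : measurable_fun setT (EFin \o f).
  apply/measurable_EFinP; apply: measurable_funM; first exact: measurable_indic.
  apply: measurable_funM; first exact: (measurableT_comp mc m2).
  exact: (measurableT_comp me m1).
have f0 p : (0 <= (EFin \o f) p)%E.
  by rewrite lee_fin mulr_ge0 ?indicE// mulr_ge0 ?expR_ge0.
have fu (t : R) : (\int[lam]_u (f (t, u))%:E =
    (\1_(`]0%R, +oo[ : set R) t * (t `^ (z + 1 - 1) * expR (- t)))%:E)%E.
  have [t0|t0] := leP t 0.
    rewrite integral0_eq => [|u _]; last first.
      rewrite /f indicE memNset ?mul0r//= => -[/= u0].
      by rewrite subr_gt0 ltNge (le_trans t0 (ltW u0)).
    by rewrite indicE memNset ?mul0r//= in_itv/= andbT; apply/negP; rewrite -leNgt.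
  have AE (u : R) : \1_A (t, u) = \1_(`]0%R, t[ : set R) u :> R.
    rewrite !indicE; congr (nat_of_bool _)%:R; apply/idP/idP => /set_mem.
      by move=> [/= u0 ut]; apply/mem_set; rewrite /= in_itv/= u0 -subr_gt0.
    rewrite /= in_itv/= => /andP[u0 ut]; apply/mem_set; split => //=.
    by rewrite subr_gt0.
  transitivity (\int[lam]_(u in `]0%R, t[) ((z * expR (- t))%:E * (u `^ (z - 1))%:E))%E.
    under [RHS]eq_integral do rewrite -EFinM.
    rewrite [RHS]integral_mkindic; apply: eq_integral => u _; rewrite /f /c /= AE.
    by congr (_ * _)%:E; rewrite mulrAC.
  rewrite ge0_integralZl//; last 3 first.
  - by apply: measurable_funTS; apply/measurable_EFinP; exact: measurable_powR.
  - by move=> u _; rewrite lee_fin powR_ge0.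
  - by rewrite lee_fin mulr_ge0 ?expR_ge0 ?ltW.
  rewrite integral_powR ?subr_gt0// subrK addrK -EFinM.
  rewrite indicE mem_set ?mul1r/=; last by rewrite in_itv/= t0.
  by congr EFin; field; rewrite gt_eqF.
have ft (u : R) : (\int[lam]_t (f (t, u))%:E =
    (\1_(`]0%R, +oo[ : set R) u * (z * (u `^ (z - 1) * expR (- u))))%:E)%E.
  have [u0|u0] := leP u 0.
    rewrite integral0_eq => [|t _]; last first.
      rewrite /f indicE memNset ?mul0r//= => -[/=].
      by rewrite ltNge u0.
    by rewrite indicE memNset ?mul0r//= in_itv/= andbT; apply/negP; rewrite -leNgt.
  have AE (t : R) : \1_A (t, u) = \1_(`]u, +oo[ : set R) t :> R.
    rewrite !indicE; congr (nat_of_bool _)%:R; apply/idP/idP => /set_mem.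
      by move=> [/= _ ut]; apply/mem_set; rewrite /= in_itv/= andbT -subr_gt0.
    rewrite /= in_itv/= andbT => ut; apply/mem_set; split => //=.
    by rewrite subr_gt0.
  transitivity (\int[lam]_(t in `]u, +oo[) ((c u)%:E * (expR (- t))%:E))%E.
    under [RHS]eq_integral do rewrite -EFinM.
    by rewrite [RHS]integral_mkindic; apply: eq_integral => t _; rewrite /f /= AE.
  rewrite ge0_integralZl//; last 2 first.
  - by apply: measurable_funTS; apply/measurable_EFinP.
  - by rewrite lee_fin.
  rewrite integral_expRN -EFinM indicE mem_set ?mul1r/=; last by rewrite in_itv/= u0.
  by rewrite /c mulrA.
have key : (\int[lam]_(t in `]0%R, +oo[) (t `^ (z + 1 - 1) * expR (- t))%:E =
    z%:E * \int[lam]_(t in `]0%R, +oo[) (t `^ (z - 1) * expR (- t))%:E)%E.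
  rewrite -ge0_integralZl//; last 3 first.
  - apply: measurable_funTS; apply/measurable_EFinP; apply: measurable_funM => //.
  - by move=> t _; rewrite lee_fin mulr_ge0 ?powR_ge0 ?expR_ge0.
  - by rewrite lee_fin ltW.
  under [RHS]eq_integral do rewrite -EFinM.
  rewrite [LHS]integral_mkindic [RHS]integral_mkindic.
  transitivity (\int[lam]_t \int[lam]_u (f (t, u))%:E)%E.
    by apply: eq_integral => t _; rewrite fu.
  transitivity (\int[lam]_u \int[lam]_t (f (t, u))%:E)%E.
    exact: (@fubini_tonelli _ _ _ _ _ lam lam (EFin \o f) mf f0).
  by apply: eq_integral => u _; rewrite [LHS]ft.
rewrite /Gamma /Rintegral key.
set I := (\int[_]_(_ in _) _)%E.
have I0 : (0 <= I)%E.
  by apply: integral_ge0 => t _; rewrite lee_fin mulr_ge0 ?powR_ge0 ?expR_ge0.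
(* If the integral is [+oo], so is its product with [z], and [fine] sends both to 0; the identity
   holds in that case too. *)
move: I0; case: I => [r| |] //=.
by move=> _; rewrite gt0_muley ?lte_fin//= mulr0.
Qed.

(** If [e] is below a threshold, so is t e for every t < 1, hence G (t e) is close to [L] uniformly
    in t. The weight t^a is at most 1 and has integral 1/(a+1). *)
Lemma cvg_dilation_average (a L : R) (G : R -> R) : 0 < a ->
  (forall e, 0 < e -> lam.-integrable `]0, 1[ (EFin \o (fun t : R => t `^ a * G (t * e)))) ->
  G e @[e --> 0^'+] --> L ->
  \int[lam]_(t in `]0, 1[) (t `^ a * G (t * e)) @[e --> 0^'+] --> L / (a + 1).
Proof.
move=> a0 iG GL.
have mI : measurable (`]0, 1[%classic : set (measurableTypeR R)) by exact: measurable_itv.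
have lamI : lam `]0%R, 1%R[%classic = 1%E.
  by rewrite lebesgue_measure_itv/= lte_fin ltr01 -EFinB subr0.
have ia0 : lam.-integrable `]0, 1[ (EFin \o (fun t : R => t `^ a)).
  apply/integrableP; split.
    by apply: measurable_funTS; apply/measurable_EFinP; exact: measurable_powR.
  under eq_integral do rewrite gee0_abs ?lee_fin ?powR_ge0//.
  by rewrite integral_powR// ltry.
have ia : lam.-integrable `]0, 1[ (EFin \o (fun t : R => t `^ a * L)).
  exact: (integrableZr mI L ia0).
have La : L / (a + 1) = \int[lam]_(t in `]0, 1[) (t `^ a * L).
  by rewrite RintegralZr// /Rintegral integral_powR//= powR1 mul1r mulrC.
apply/cvgrPdist_le => eps eps0.
move/cvgrPdist_le : GL => /(_ _ eps0) [d /= d0 Gd].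
near=> e.
have e0 : 0 < e by near: e; exact: nbhs_right_gt.
have ed : e < d by near: e; exact: nbhs_right_lt.
have iB : lam.-integrable `]0, 1[
    (EFin \o (fun t : R => t `^ a * L - t `^ a * G (t * e))).
  exact: (integrableB mI ia (iG e e0)).
rewrite La -RintegralB//; last exact: iG.
apply: (le_trans (le_normr_Rintegral mI iB)).
apply: (@le_trans _ _ (\int[lam]_(t in `]0, 1[) eps)).
  apply: le_Rintegral => //.
  - exact: (integrable_abse iB).
  - apply/integrableP; split; first exact: measurable_cst.
    by rewrite integral_cst//= lamI mule1 ltry.
  - move=> t; rewrite /= in_itv/= => /andP[t0 t1].
    have te0 : 0 < t * e by rewrite mulr_gt0.
    rewrite -mulrBr normrM ger0_norm ?powR_ge0//.
    apply: (@le_trans _ _ `|L - G (t * e)|).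
      have : t `^ a <= 1 `^ a by apply: ge0_ler_powR; rewrite ?nnegrE//; exact: ltW.
      by rewrite powR1 => ta; rewrite ler_piMl.
    apply: Gd => //=; rewrite sub0r normrN gtr0_norm// (lt_trans _ ed)//.
    by rewrite gtr_pMl.
by rewrite Rintegral_cst//= lamI mulr1.
Unshelve. all: by end_near. Qed.

End one_dimensional.

(** * Principal values *)

Section holder_field.
Context {R : realType} {n : nat}.
Notation mu := (lebesgue_rV n.+1 : {measure set 'rV[R]_n.+1 -> \bar R}).
Variables (s beta r K M : R) (g : 'rV[R]_n.+1 -> 'rV[R]_n.+1) (x : 'rV[R]_n.+1).
Hypotheses (s_gt : 1 < 2 * s) (beta_gt : 2 * s - 1 < beta) (r0 : 0 < r).
Hypothesis mg : forall i, measurable_fun setT (fun z => g z 0 i).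
Hypothesis gM : forall z, enorm (g z) <= M.
Hypothesis gK : forall y, enorm (y - x) <= r ->
  enorm (g y - g x) <= K * enorm (y - x) `^ beta.

Let p : R := n.+1%:R + 2 * s.
(** The degree of the kernel field improved by the Hölder exponent: N + q = beta - (2s - 1) > 0, so
    this power is integrable near 0. *)
Let q : R := beta + (1 - p).
Let q_gt : 0 < n.+1%:R + q.
Proof.
rewrite (_ : n.+1%:R + q = beta - (2 * s - 1)) ?subr_gt0//.
by rewrite /q /p; ring.
Qed.

Let A (a b : R) : set 'rV[R]_n.+1 := [set y | annulus a b (y - x)].
Let G0 (y : 'rV[R]_n.+1) : R := dotv (Defs.kernel s (y - x) *: (y - x)) (g y).
Let C0 (y : 'rV[R]_n.+1) : R := dotv (Defs.kernel s (y - x) *: (y - x)) (g x).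
(** [C0] freezes the field at [x] and cancels by oddness; the remainder [H] is absolutely integrable
    near [x]. *)
Let H (y : 'rV[R]_n.+1) : R := G0 y - C0 y.

Let mA a b : measurable (A a b).
Proof.
have := measurable_affine_preimage 1 (- x) _ (@measurable_annulus R n.+1 a b).
by rewrite scale1_affine.
Qed.

Let iG e : 0 < e -> mu.-integrable (pv_dom setT x e) (EFin \o G0).
Proof. exact: (field_integrand_integrable s M g x). Qed.

Let iC e : 0 < e -> mu.-integrable (pv_dom setT x e) (EFin \o C0).
Proof.
exact: (field_integrand_integrable s M (fun=> g x) x s_gt).
Qed.

Let subA e b : A e b `<=` pv_dom setT x e.
Proof. by move=> y []. Qed.

(** The reflection y |-> 2x - y preserves the annulus and the measure and changes the sign of [C0],
    so the integral equals its opposite. *)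
Let integral_C0 e : 0 < e -> \int[mu]_(y in A e r) C0 y = 0.
Proof.
move=> e0.
have iCA : mu.-integrable (A e r) (EFin \o C0).
  by apply: integrableS (iC e e0) => //; exact: measurable_pv_dom.
pose phi (y : 'rV[R]_n.+1) := (-1) *: y + (x + x).
have phiB y : phi y - x = - (y - x).
  by rewrite /phi scaleN1r opprB addrA addrK addrC.
have := Rintegral_affine (-1) (x + x) _ _ _ (mA e r) iCA.
rewrite -/phi oppr_eq0 oner_eq0 => /(_ isT).
rewrite (_ : phi @^-1` A e r = A e r); last first.
  by apply/seteqP; split => y; rewrite /A /preimage /annulus /= phiB enormN.
rewrite normrN1 invr1 expr1n mul1r.
rewrite (@eq_Rintegral _ _ _ _ _ (fun y => (-1) * C0 y)); last first.
  move=> y _; rewrite /C0 phiB /Defs.kernel enormN scalerN.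
  by rewrite -[X in dotv X _]scaleN1r [LHS]dotvZl.
rewrite RintegralZl// mulN1r => h; lra.
Qed.

Let H_le y : A 0 r y -> `|H y| <= `|K| * enorm (y - x) `^ q.
Proof.
move=> [y0 yr]; rewrite /H /G0 /C0 -dotvBr (le_trans (dotv_le _ _))//.
rewrite enorm_kernel// -/p /q [beta + _]addrC [X in _ <= _ * X]powRD;
  last by apply/implyP => _; rewrite gt_eqF.
rewrite mulrCA ler_wpM2l ?powR_ge0// (le_trans (gK _ yr))//.
by rewrite ler_wpM2r ?powR_ge0// ler_norm.
Qed.

Let iH : mu.-integrable (A 0 r) (EFin \o H).
Proof.
apply: (le_integrable (mA 0 r) _ _
  (integrableZl (mA 0 r) `|K| (integrable_radial_0 x r q r0 q_gt))).
  apply/measurable_EFinP; apply: measurable_funTS; apply: measurable_funB.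
    exact: measurable_field_integrand.
  by apply: measurable_field_integrand => i; exact: measurable_cst.
move=> y Ay; rewrite -EFinM !abse_EFin lee_fin.
by rewrite [leRHS]ger0_norm ?mulr_ge0 ?powR_ge0// H_le.
Qed.

(** Dilation by [e] about [x]. The positive exponent N + q supplies the rate at which the integral
    over a shrinking ball vanishes. *)
Let radial_scaling e : 0 < e ->
  \int[mu]_(y in A 0 e) (enorm (y - x) `^ q) =
  e `^ (n.+1%:R + q) * \int[mu]_(y in A 0 1) (enorm (y - x) `^ q).
Proof.
move=> e0.
have eV0 : 0 < e^-1 by rewrite invr_gt0.
have i1 := integrable_radial_0 x 1 q ltr01 q_gt.
have ie := integrable_radial_0 x e q e0 q_gt.
pose phi (y : 'rV[R]_n.+1) := e^-1 *: y + (x - e^-1 *: x).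
have phiB y : phi y - x = e^-1 *: (y - x) by rewrite /phi -affine_sub [LHS]addrC addKr.
have := Rintegral_affine e^-1 (x - e^-1 *: x) _ _ _ (mA 0 1) i1.
rewrite -/phi gt_eqF// => /(_ isT).
rewrite (_ : phi @^-1` A 0 1 = A 0 e); last first.
  apply/seteqP; split => y; rewrite /A /preimage /annulus /= phiB enormZ gtr0_norm//;
    by rewrite pmulr_rgt0// ler_pdivrMl// mulr1.
rewrite gtr0_norm// invrK.
rewrite (@eq_Rintegral _ _ _ _ _ (fun y : 'rV[R]_n.+1 =>
    e `^ (- q) * enorm (y - x) `^ q)); last first.
  move=> y _; rewrite phiB enormZ gtr0_norm// powRM ?enorm_ge0 ?ltW//.
  by rewrite -powR_inv1 ?ltW// -powRrM mulN1r.
rewrite RintegralZl// => h.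
rewrite powRD; last by apply/implyP => _; rewrite gt_eqF.
rewrite powR_mulrn ?ltW// mulrAC -h powRN mulrC mulrA mulfV ?mul1r//.
by rewrite gt_eqF// powR_gt0.
Qed.

Let cvg_inner : \int[mu]_(y in A 0 e) H y @[e --> 0^'+] --> (0 : R).
Proof.
pose C1 := \int[mu]_(y in A 0 1) (enorm (y - x) `^ q).
have c0 : `|K| * (e `^ (n.+1%:R + q) * C1) @[e --> (0:R)^'+] --> (0 : R).
  rewrite -[X in _ --> X](mulr0 `|K|); apply: cvgMl_tmp; rewrite -[X in _ --> X](mul0r C1).
  by apply: cvgMr_tmp; exact: powR_cvg0.
apply/cvgrPdist_le => eps eps0.
move/cvgrPdist_le : c0 => /(_ _ eps0) c0.
near=> e.
have e0 : 0 < e by near: e; exact: nbhs_right_gt.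
have er : e <= r by near: e; exact: nbhs_right_le.
have sub : A 0 e `<=` A 0 r by move=> y [y0 ye]; split => //; exact: le_trans er.
have iHe : mu.-integrable (A 0 e) (EFin \o H) by apply: integrableS iH.
have ie := integrable_radial_0 x e q e0 q_gt.
rewrite sub0r normrN (le_trans (le_normr_Rintegral _ iHe))//.
apply: (@le_trans _ _ (\int[mu]_(y in A 0 e) (`|K| * enorm (y - x) `^ q))).
  apply: le_Rintegral => //; first exact: (integrable_abse iHe).
    exact: (integrableZl (mA 0 e) `|K| ie).
  by move=> y /sub; exact: H_le.
rewrite RintegralZl// radial_scaling// -/C1.
apply: le_trans (ler_norm _) _; rewrite -normrN -sub0r.
by near: e; exact: c0.
Unshelve. all: by end_near. Qed.

(** Since [C0] integrates to 0 over the annulus from e to r, the truncated integral is that of [H]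
    over [A 0 r], minus that of [H] over [A 0 e], plus a far part independent of e. Only the middle
    term varies, and it tends to 0. *)
Lemma is_cvg_field_integral :
  cvg (\int[mu]_(y in pv_dom setT x e)
    dotv (Defs.kernel s (y - x) *: (y - x)) (g y) @[e --> 0^'+]).
Proof.
pose L := \int[mu]_(y in A 0 r) H y.
pose L' := \int[mu]_(y in pv_dom setT x r) G0 y.
apply/cvg_ex; exists (L - 0 + L').
have : L - \int[mu]_(y in A 0 e) H y + L' @[e --> 0^'+] --> L - 0 + L'.
  by apply: cvgD; [apply: cvgB => //|]; exact: cvg_cst.
apply: cvg_trans; apply: near_eq_cvg; near=> e.
have e0 : 0 < e by near: e; exact: nbhs_right_gt.
have er : e < r by near: e; exact: nbhs_right_lt.
have domE : pv_dom setT x e = A e r `|` pv_dom setT x r.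
  apply/seteqP; split => [y [_ ey]|y [[ey _]|[_ ry]]]; [|by []|by split => //; exact: lt_trans ry].
  by have [yr|yr] := leP (enorm (y - x)) r; [left|right].
have AE : A 0 r = A 0 e `|` A e r.
  apply/seteqP; split => [y [y0 yr]|y [[y0 ye]|[ey yr]]].
  - by have [ye|ye] := leP (enorm (y - x)) e; [left|right].
  - by split => //; rewrite (le_trans ye)// ltW.
  - by split => //; exact: lt_trans ey.
rewrite -/(G0 _) domE Rintegral_setU//=.
- congr (_ + _).
  have -> : \int[mu]_(y in A e r) G0 y = \int[mu]_(y in A e r) H y.
    rewrite RintegralB ?integral_C0 ?subr0//.
      by apply: integrableS (iG e e0) => //; exact: measurable_pv_dom.
    by apply: integrableS (iC e e0) => //; exact: measurable_pv_dom.
  rewrite /L AE Rintegral_setU//= -?AE//; first by rewrite addrAC subrr add0r.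
  apply/disj_set2P/seteqP; split => // y [[_ ye] [ey _]].
  by move: ey; rewrite ltNge ye.
- exact: measurable_pv_dom.
- by rewrite -domE; exact: iG.
- apply/disj_set2P/seteqP; split => // y [[_ yr] [_ ry]].
  by move: ry; rewrite /= ltNge yr.
Unshelve. all: by end_near. Qed.

End holder_field.

(** * The gradient field on the half-space *)

Section main.
Context {R : realType} {n : nat}.
Notation mu := (lebesgue_rV n.+1 : {measure set 'rV[R]_n.+1 -> \bar R}).
Variables (s beta : R) (psi : 'rV[R]_n.+1 -> R) (x : 'rV[R]_n.+1).
Hypotheses (s_gt : 1 < 2 * s) (beta_gt : 2 * s - 1 < beta).
Hypothesis psiC : C1beta beta half_space psi.
Hypothesis Ox : half_space x.

(** Outside the half-space [grad psi] carries no information. The value 0 turns integrals over the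
    half-space into integrals over the whole space, and stops the integral along a segment at its
    exit from the half-space. *)
Definition zero_extended_grad (y : 'rV[R]_n.+1) : 'rV[R]_n.+1 :=
  if y \in half_space then grad psi y else 0.
Let g := zero_extended_grad.

Let mg i : measurable_fun setT (fun z => g z 0 i).
Proof.
have mO : measurable (@half_space R n) by apply: open_measurable_rV; exact: open_half_space.
rewrite (_ : (fun z => g z 0 i) = (fun z => grad psi z 0 i) \_ half_space).
  apply/(measurable_restrictT _ mO); apply: open_continuous_measurable_fun_rV.
    exact: open_half_space.
  move=> z Oz; have [C1psi _ _] := psiC.
  apply: (@continuous_comp _ _ _ (grad psi) (fun u : 'rV[R]_n.+1 => u 0 i)).
    exact: (C1psi z Oz).2.
  exact: coord_continuous.
by apply/funext => z; rewrite /g /zero_extended_grad patchE; case: ifP => //; rewrite mxE.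
Qed.

Let g_bounded : exists M, forall z, enorm (g z) <= M.
Proof.
have [_ [M gM] _] := psiC; exists M => z; rewrite /g /zero_extended_grad.
case: ifPn => [/set_mem|_]; first exact: gM.
by rewrite enorm0 (le_trans (enorm_ge0 _) (gM x Ox)).
Qed.

(** Half the distance from [x] to the boundary: the closed ball of this radius stays in the
    half-space, where the Hölder bound on the gradient is available. *)
Let r : R := x 0 ord_max / 2.
Let r0 : 0 < r. Proof. by rewrite divr_gt0. Qed.

Let ball_half_space y : enorm (y - x) <= r -> half_space y.
Proof.
move=> yr; rewrite /half_space /=.
have := le_trans (coord_le_enorm (y - x) ord_max) yr.
rewrite !mxE ler_norml => /andP[h _].
have x0 : 0 < x 0 ord_max := Ox.
move: h; rewrite /r; lra.
Qed.

Let g_holder : exists K, forall y, enorm (y - x) <= r ->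
  enorm (g y - g x) <= K * enorm (y - x) `^ beta.
Proof.
have [_ _ [K gK]] := psiC; exists K => y /ball_half_space Oy.
by rewrite /g /zero_extended_grad !mem_set//; exact: gK.
Qed.

Let G0 (y : 'rV[R]_n.+1) : R := dotv (Defs.kernel s (y - x) *: (y - x)) (g y).
Let G (e : R) : R := \int[mu]_(y in pv_dom setT x e) G0 y.

Let grad_integral e : \int[mu]_(y in pv_dom half_space x e) grad_integrand s psi x y = G e.
Proof.
rewrite /G Rintegral_mkcond [RHS]Rintegral_mkcond; congr (Rintegral _ _ _).
apply/funext => y; rewrite !patchE /G0 /g /zero_extended_grad.
have [Oy|nOy] := pselect (half_space y).
  rewrite (mem_set Oy) (_ : (y \in pv_dom half_space x e) = (y \in pv_dom setT x e))//.
  by apply/idP/idP => /set_mem[_ ey]; apply/mem_set.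
rewrite (memNset (u := y)); last by case.
rewrite (memNset nOy); case: ifP => // _.
by rewrite dotv0r.
Qed.

Let jumpE y : jump_integrand s psi x y =
  (\int[lebesgue_measure]_(t in `]0, 1[) dotv (y - x) (g (x + t *: (y - x)))) *
  Defs.kernel s (y - x).
Proof.
have [C1psi [M gM] _] := psiC.
rewrite /jump_integrand (extension_integral psi M C1psi gM x y Ox); congr (_ * _).
apply: eq_Rintegral => t _; rewrite /g /zero_extended_grad; case: ifP => // _.
by rewrite dotv0r.
Qed.

Lemma pv_grad_exists : pv_exists half_space x (grad_integrand s psi x).
Proof.
have [M gM] := g_bounded; have [K gK] := g_holder.
split => [e e0|]; last first.
  rewrite (_ : (fun e => _) = G); last by apply/funext => e; exact: grad_integral.
  exact: (is_cvg_field_integral s beta r K M g x s_gt beta_gt r0 mg gM gK).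
have mO : measurable (@half_space R n) by apply: open_measurable_rV; exact: open_half_space.
have mE := measurable_pv_dom half_space x e mO.
have sub : pv_dom half_space x e `<=` pv_dom setT x e by move=> y [].
have := integrableS (measurable_pv_dom setT x e measurableT) mE sub
  (field_integrand_integrable s M g x s_gt mg gM e e0).
apply: eq_integrable => // y /set_mem[Oy _].
by rewrite /= /g /zero_extended_grad mem_set.
Qed.

Lemma cvg_pv_jump : \int[mu]_(y in pv_dom setT x e) jump_integrand s psi x y
  @[e --> 0^'+] --> pv half_space x (grad_integrand s psi x) / (2 * s).
Proof.
have [M gM] := g_bounded; have [_ cG] := pv_grad_exists.
have GL : G e @[e --> 0^'+] --> pv half_space x (grad_integrand s psi x).
  rewrite (_ : G = fun e => \int[mu]_(y in pv_dom half_space x e) grad_integrand s psi x y).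
    exact: cG.
  by apply/funext => e; rewrite grad_integral.
have s1 : 0 < 2 * s - 1 by rewrite subr_gt0.
(* Writes 2s as (2s - 1) + 1, the a + 1 of the averaging lemma with a = 2s - 1. *)
rewrite -[X in _ / X](subrK 1).
have := cvg_dilation_average _ _ _ s1 (dilation_integrable s M g x s_gt mg gM) GL.
apply: cvg_trans; apply: near_eq_cvg; near=> e.
have e0 : 0 < e by near: e; exact: nbhs_right_gt.
rewrite -(segment_dilation s M g x s_gt mg gM e e0).
by apply: eq_Rintegral => y _; rewrite jumpE.
Unshelve. all: by end_near. Qed.

Lemma pv_jump_exists : pv_exists setT x (jump_integrand s psi x).
Proof.
have [M gM] := g_bounded; split => [e e0|]; last exact: cvgP cvg_pv_jump.
have := segment_integrable s M g x s_gt mg gM e e0.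
by congr (mu.-integrable _ _); apply/funext => y; rewrite /= jumpE.
Qed.

End main.

Theorem lemma3p7 (R : realType) (n : nat) (nu0 gamma s beta : R)
    (psi : 'rV[R]_n.+1 -> R)
    (nu0_gt0 : 0 < nu0) (gamma_gt0 : 0 < gamma)
    (s_gt : 1 / 2 < s) (s_lt : s < 1)
    (beta_gt0 : 0 < beta) (beta_lt1 : beta < 1) (beta_gt : 2 * s - 1 < beta)
    (psiC : C1beta beta half_space psi) :
  forall x, half_space x ->
    [/\ pv_exists setT x (jump_integrand s psi x),
        pv_exists half_space x (grad_integrand s psi x) &
        calL gamma nu0 s psi x =
          gamma * nu0 `^ (1 - 2 * s) * Gamma (2 * s) *
          pv half_space x (grad_integrand s psi x)].
Proof.
move=> x Ox.
have s2 : 1 < 2 * s by lra.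
split.
- exact: (pv_jump_exists s beta).
- exact: (pv_grad_exists s beta).
rewrite /calL (_ : pv setT x _ = pv half_space x (grad_integrand s psi x) / (2 * s)).
  by rewrite GammaD1//; field; lra.
by apply: cvg_lim => //; exact: (cvg_pv_jump s beta).
Qed.
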